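(* Let $c$ be a Coxeter element of $W$. For every function $f:I\to\mathbb{R}$ such that $f(i)=f(i^* )$ for all $i\in I$ and $\sum_{i\in I}a_{ij}f(i)>0$ for all $j\in I$, there exists a point $a$ in the fundamental Weyl chamber $D$ such that $\mathrm{Asso}_c^a(W)=\mathrm{Asso}_c^f(W)$.
   Context: Let $I$ be a finite type Dynkin diagram (vertex set $I$), with crystallographic root system, simple roots $\alpha_i$, fundamental weights $\omega_i$, weight lattice $P$, $P_\mathbb{R}=P\otimes\mathbb{R}$ equipped with a $W$-invariant inner product $(\cdot,\cdot)$, dual $P_\mathbb{R}^*$, Weyl group $W$ with simple reflections $s_i$, longest element $w_0$, Cartan matrix $(a_{ij})$ with $\alpha_j=\sum_i a_{ij}\omega_i$. $D$ is the $\mathbb{R}_{\ge0}$-span of the fundamental weights. Let $\omega_{i^*}:=-w_0\omega_i$. A Coxeter element $c$ is a product of all $s_i$, each once; $h(i;c)$ is the minimal positive integer with $c^{h(i;c)}\omega_i=-\omega_{i^*}$; $\Pi(c):=\{c^m\omega_i:0\le m\le h(i;c)\}$. With $\tau_c(-\omega_i)=\omega_i$, $\tau_c(\lambda)=c\lambda$ otherwise, and $[\gamma;\alpha_i]$ the $\alpha_i$-coefficient, the compatibility degree is the unique $\tau_c$-invariant $(\bullet||\bullet)_c$ on $\Pi(c)$ with $(\omega_i||\lambda)_c=\max\{[(c^{-1}-1)\lambda;\alpha_i],0\}$; cones spanned by pairwise compatible ($(\lambda||\mu)_c=0$) subsets form a complete simplicial fan $\mathcal{F}_c^\Pi$. $F_c$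 is the continuous function on $P_\mathbb{R}$, linear on maximal cones of $\mathcal{F}_c^\Pi$, with $F_c(c^m\omega_i)=f(i)$; $\mathrm{Asso}_c^f(W):=\{\varphi\in P_\mathbb{R}^*:\varphi(\lambda)\le F_c(\lambda)\ \forall\lambda\in\Pi(c)\}$. Sorting: fix a reduced expression of $c$ and let $c^\infty$ be the infinite concatenation of copies of it. For $w\in W$, its $c$-sorting word is the reduced word for $w$ occurring as a subword of $c^\infty$ whose set of positions is lexicographically first; writing $c_J$ for the subword of $c$ using only letters $s_j$, $j\in J$, the $c$-sorting word has the form $c_{I_1}c_{I_2}\cdots c_{I_k}$ (the $c$-factorization, independent of the chosen reduced expression of $c$). $w$ is $c$-sortable if $I_1\supseteq I_2\supseteq\cdots\supseteq I_k$; $w$ is $c$-antisortable if $ww_0$ is $c^{-1}$-sortable; $w$ is a $c$-singleton if it is both. For $a\in P_\mathbb{R}$ define $\mathrm{Asso}_c^a(W):=\{\varphi\in P_\mathbb{R}^*:\varphi(w\omega_j)\le(a,\omega_j)$ for all $c$-singletons $w$ and all $j\in I\}$ (the polytope of Hohlweg–Lange–Thomas). *)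

(* Defs.v *)
(* Weights are coordinate row vectors in the basis of
   fundamental weights: lambda = \sum_i lambda 0 i * omega_i. *)
From HB Require Import structures.
From mathcomp Require Import all_boot all_order all_algebra.
From mathcomp Require Import reals.
Set Implicit Arguments. Unset Strict Implicit. Unset Printing Implicit Defensive.
Import Order.TTheory GRing.Theory Num.Theory.
Local Open Scope ring_scope.

Section Coxeter.
Variables (R : realType) (n : nat) (A : 'M[int]_n).
(* A i j = a_ij, with alpha_j = \sum_i a_ij omega_i *)

Definition gen_cartan : Prop :=
  [/\ forall i, A i i = 2,
      forall i j, i != j -> A i j <= 0
    & forall i j, A i j = 0 <-> A j i = 0].

Definition finite_type : Prop :=
  gen_cartan /\
  exists d : 'I_n -> R,
    [/\ forall i, 0 < d i,
        forall i j, d i * (A i j)%:~R = d j * (A j i)%:~R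
      & forall x : 'rV[R]_n, x != 0 ->
          0 < \sum_i \sum_j x 0 i * d i * (A i j)%:~R * x 0 j].

Definition omega (i : 'I_n) : 'rV[R]_n := delta_mx 0 i.
Definition alpha (j : 'I_n) : 'rV[R]_n := \row_i (A i j)%:~R.
(* s_i(lambda) = lambda - <lambda, alpha_i^vee> alpha_i, and
   <lambda, alpha_i^vee> is the omega_i-coordinate of lambda *)
Definition refl (i : 'I_n) (l : 'rV[R]_n) : 'rV[R]_n := l - l 0 i *: alpha i.
Definition act (w : seq 'I_n) (l : 'rV[R]_n) : 'rV[R]_n := foldr refl l w.

(* equality of the Weyl group elements represented by two words *)
Definition weq (u v : seq 'I_n) : Prop := forall l, act u l = act v l.
Definition reduced (u : seq 'I_n) : Prop :=
  forall v, weq v u -> (size u <= size v)%N.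
Definition longest (w0 : seq 'I_n) : Prop :=
  reduced w0 /\ forall u, reduced u -> (size u <= size w0)%N.

Definition istar (w0 : seq 'I_n) (i : 'I_n) : 'I_n :=
  odflt i [pick j | omega j == - act w0 (omega i)].

Definition ip (G : 'M[R]_n) (x y : 'rV[R]_n) : R := (x *m G *m y^T) 0 0.
Definition W_inv_inner (G : 'M[R]_n) : Prop :=
  [/\ G^T = G,
      forall x, x != 0 -> 0 < ip G x x
    & forall i x y, ip G (refl i x) (refl i y) = ip G x y].

(* elements of P_R^* are given by coordinates in the dual basis *)
Definition pair (phi l : 'rV[R]_n) : R := \sum_i phi 0 i * l 0 i.

Definition coxeter_word (cw : seq 'I_n) : Prop := perm_eq cw (enum 'I_n).
Definition cpow (cw : seq 'I_n) (m : nat) (l : 'rV[R]_n) := iter m (act cw) l.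

Definition is_h (w0 cw : seq 'I_n) (i : 'I_n) (h : nat) : Prop :=
  [/\ (0 < h)%N,
      cpow cw h (omega i) = - omega (istar w0 i)
    & forall k, (0 < k < h)%N -> cpow cw k (omega i) <> - omega (istar w0 i)].

Definition PiC (w0 cw : seq 'I_n) (l : 'rV[R]_n) : Prop :=
  exists i h m, [/\ is_h w0 cw i h, (m <= h)%N & l = cpow cw m (omega i)].

(* Asso_c^f(W) = {phi | phi(lambda) <= F_c(lambda) for lambda in Pi(c)};
   since F_c(c^m omega_i) = f(i) by definition of F_c, the constraint at
   lambda = c^m omega_i (0 <= m <= h(i;c)) reads phi(lambda) <= f(i). *)
Definition Asso_f (w0 cw : seq 'I_n) (f : 'I_n -> R) (phi : 'rV[R]_n) : Prop :=
  forall i h m, is_h w0 cw i h -> (m <= h)%N ->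
    pair phi (cpow cw m (omega i)) <= f i.

(* positions in c^oo are naturals p; position p carries letter cw_(p mod n) *)
Definition letters (cw : seq 'I_n) (ps : seq nat) : seq 'I_n :=
  pmap (fun p => onth cw (p %% size cw)) ps.

Fixpoint lex_le (s t : seq nat) : bool :=
  match s, t with
  | [::], _ => true
  | _ :: _, [::] => false
  | x :: s', y :: t' => (x < y)%N || ((x == y) && lex_le s' t')
  end.

Definition valid_pos (cw u : seq 'I_n) (ps : seq nat) : Prop :=
  [/\ sorted ltn ps, reduced (letters cw ps) & weq (letters cw ps) u].

Definition sorting_pos (cw u : seq 'I_n) (ps : seq nat) : Prop :=
  valid_pos cw u ps /\ forall qs, valid_pos cw u qs -> lex_le ps qs.

(* I_(j+1): letters used in the (j+1)-th copy of c *)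
Definition block (cw : seq 'I_n) (ps : seq nat) (j : nat) : {set 'I_n} :=
  [set x in letters cw [seq p <- ps | p %/ size cw == j]%N].

Definition sortable (cw u : seq 'I_n) : Prop :=
  exists ps, sorting_pos cw u ps /\
    forall j, block cw ps j.+1 \subset block cw ps j.

(* u w0 is c^{-1}-sortable; rev cw is a reduced expression of c^{-1} *)
Definition antisortable (w0 cw u : seq 'I_n) : Prop := sortable (rev cw) (u ++ w0).
Definition singleton (w0 cw u : seq 'I_n) : Prop :=
  sortable cw u /\ antisortable w0 cw u.

Definition Asso_a (G : 'M[R]_n) (w0 cw : seq 'I_n) (a phi : 'rV[R]_n) : Prop :=
  forall u, singleton w0 cw u -> forall j,
    pair phi (act u (omega j)) <= ip G a (omega j).

End Coxeter.

(* Main.v *)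
Require Import Defs.
From HB Require Import structures.
From mathcomp Require Import all_boot all_order all_algebra.
From mathcomp Require Import reals.
From mathcomp Require Import ring lra zify.
Set Implicit Arguments. Unset Strict Implicit. Unset Printing Implicit Defensive.
Import Order.TTheory GRing.Theory Num.Theory.
Local Open Scope ring_scope.

(* Choose a with (a, omega_j) = f(j); the inequalities on f say that a is
   dominant. Both polytopes are then cut out by inequalities
   phi(lambda) <= f(j) with lambda in the orbit of omega_j, and it suffices to
   show that the weights u omega_j, u a c-singleton, are exactly the weights
   c^m omega_j, 0 <= m <= h(j;c).
   A set of letters of c^oo that is an order ideal of its heap spells a word u
   with u omega_j = c^k omega_j, k being the number of letters s_j used: the
   skipped letters commute with all later ones. The roots along this word are
   c^m (1 - c) omega_i; they are positive exactly for m < h(i;c) at first, which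
   makes the word reduced, and the heights h(i;c) themselves form an ideal
   spelling w0. Ideals below these heights give c-singletons, and all the weights
   c^m omega_j are obtained in this way.
   Conversely, in a sorting word with nested blocks the Euler form
   E(x, y) = B((1 - c)^-1 x, y) is nonpositive on a later and an earlier root.
   Applied to u and, for c^-1, to u w0, whose inversions are complementary, this
   sign condition forces the letters of a c-singleton u to form an ideal. *)

(** * Bilinearity of the inner product *)

Section InnerProduct.
Variables (R : realType) (n : nat) (G : 'M[R]_n).
Implicit Types x y : 'rV[R]_n.

Lemma ipDl x1 x2 y : ip G (x1 + x2) y = ip G x1 y + ip G x2 y.
Proof. by rewrite /ip !mulmxDl mxE. Qed.

Lemma ipZl k x y : ip G (k *: x) y = k * ip G x y.
Proof. by rewrite /ip -!scalemxAl mxE. Qed.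

Lemma ipNl x y : ip G (- x) y = - ip G x y.
Proof. by rewrite -scaleN1r ipZl mulN1r. Qed.

Lemma ipBl x1 x2 y : ip G (x1 - x2) y = ip G x1 y - ip G x2 y.
Proof. by rewrite ipDl ipNl. Qed.

Lemma ip0l y : ip G 0 y = 0.
Proof. by rewrite -(scale0r y) ipZl mul0r. Qed.

Lemma ip_suml (I : finType) (P : pred I) (F : I -> 'rV[R]_n) y :
  ip G (\sum_(i | P i) F i) y = \sum_(i | P i) ip G (F i) y.
Proof.
apply: (big_rec2 (fun a b => ip G a y = b)); first exact: ip0l.
by move=> i s t _ <-; rewrite ipDl.
Qed.

Hypothesis Gsym : G^T = G.

Lemma ipC x y : ip G x y = ip G y x.
Proof.
rewrite /ip -[x *m G *m y^T]trmxK mxE.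
by rewrite !trmx_mul trmxK Gsym mulmxA.
Qed.

Lemma ipDr x y1 y2 : ip G x (y1 + y2) = ip G x y1 + ip G x y2.
Proof. by rewrite ipC ipDl !(ipC x). Qed.

Lemma ipZr k x y : ip G x (k *: y) = k * ip G x y.
Proof. by rewrite ipC ipZl ipC. Qed.

Lemma ipNr x y : ip G x (- y) = - ip G x y.
Proof. by rewrite ipC ipNl ipC. Qed.

Lemma ipBr x y1 y2 : ip G x (y1 - y2) = ip G x y1 - ip G x y2.
Proof. by rewrite ipDr ipNr. Qed.

Lemma ip_sumr (I : finType) (P : pred I) (F : I -> 'rV[R]_n) x :
  ip G x (\sum_(i | P i) F i) = \sum_(i | P i) ip G x (F i).
Proof. by rewrite ipC ip_suml; apply: eq_bigr => i _; exact: ipC. Qed.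

End InnerProduct.

(** * The linear action of words on weights *)

Section Action.
Variables (R : realType) (n : nat) (A : 'M[int]_n).
Implicit Types (x y : 'rV[R]_n) (u v w : seq 'I_n).

Lemma refl_is_linear i : linear (@refl R n A i).
Proof.
move=> k x y; rewrite /refl !mxE scalerDl scalerBr opprD scalerA.
by rewrite addrACA.
Qed.
HB.instance Definition _ i :=
  GRing.isLinear.Build R 'rV[R]_n 'rV[R]_n *:%R (@refl R n A i)
    (refl_is_linear i).

Lemma act_is_linear w : linear (@act R n A w).
Proof. by elim: w => [//|i w IH] k x y /=; rewrite IH linearP. Qed.
HB.instance Definition _ w :=
  GRing.isLinear.Build R 'rV[R]_n 'rV[R]_n *:%R (@act R n A w)
    (act_is_linear w).

Lemma act_cat u v x : act A (u ++ v) x = act A u (act A v x).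
Proof. by rewrite /act foldr_cat. Qed.

Lemma act_rcons u i x : act A (rcons u i) x = act A u (refl A i x).
Proof. by rewrite -cats1 act_cat. Qed.

Lemma act_cons u i x : act A (i :: u) x = refl A i (act A u x).
Proof. by []. Qed.

Lemma omegaE (i j : 'I_n) : omega R i 0 j = (i == j)%:R.
Proof. by rewrite /omega mxE eqxx eq_sym. Qed.

Lemma refl_omega i : refl A i (omega R i) = omega R i - alpha R A i.
Proof. by rewrite /refl omegaE eqxx scale1r. Qed.

Lemma refl_omega_neq i j : i != j -> refl A i (omega R j) = omega R j.
Proof.
by move=> ij; rewrite /refl omegaE eq_sym (negPf ij) scale0r subr0.
Qed.

Lemma act_omega_notin w i : i \notin w -> act A w (omega R i) = omega R i.
Proof.
elim: w => [//|j w IH]; rewrite inE negb_or act_cons => /andP[ij /IH ->].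
by rewrite refl_omega_neq // eq_sym.
Qed.

Lemma alpha_sum j : alpha R A j = \sum_i (A i j)%:~R *: omega R i.
Proof.
apply/rowP => k; rewrite summxE mxE (bigD1 k) //= big1 ?addr0.
  by rewrite mxE omegaE eqxx mulr1.
by move=> i ik; rewrite mxE omegaE (negPf ik) mulr0.
Qed.

Lemma act_omega_eq w w' :
  (forall i, act A w (omega R i) = act A w' (omega R i)) ->
  forall x, act A w x = act A w' x.
Proof.
move=> h x; rewrite (row_sum_delta x) !linear_sum; apply: eq_bigr => i _.
by rewrite !linearZ; congr (_ *: _); exact: h.
Qed.

Lemma omega_inj : injective (@omega R n).
Proof.
move=> i j /rowP/(_ i); rewrite !omegaE eqxx.
by case: eqP => [->//|_] /eqP; rewrite oner_eq0.
Qed.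

End Action.

(** * Simple-root coordinates and the positive cone *)

Section Geometry.
Variables (R : realType) (n : nat) (A : 'M[int]_n) (G : 'M[R]_n).
Hypotheses (HA : gen_cartan A) (HG : W_inv_inner A G).
Implicit Types (x y : 'rV[R]_n) (u v w : seq 'I_n).
Local Notation B := (ip G).
Local Notation al := (alpha R A).
Local Notation om := (@omega R n).

Let Gsym : G^T = G. Proof. by case: HG. Qed.
Let BC := ipC Gsym.
Let BDr := ipDr Gsym.
Let BBr := ipBr Gsym.
Let BZr := ipZr Gsym.
Let BNr := ipNr Gsym.

Lemma ip_gt0 x : x != 0 -> 0 < B x x.
Proof. by case: HG => _ h _; exact: h. Qed.

Lemma ip_refl i x y : B (refl A i x) (refl A i y) = B x y.
Proof. by case: HG. Qed.

Lemma ip_act w x y : B (act A w x) (act A w y) = B x y.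
Proof. by elim: w => [//|i w IH]; rewrite !act_cons ip_refl. Qed.

Lemma alpha_diag i : al i 0 i = 2.
Proof. by case: HA => h _ _; rewrite mxE h. Qed.

Lemma alpha_neq0 i : al i != 0.
Proof.
apply/eqP => /rowP/(_ i); rewrite alpha_diag mxE => /eqP.
by rewrite pnatr_eq0.
Qed.

Lemma refl_alpha i : refl A i (al i) = - al i.
Proof. by rewrite /refl alpha_diag scalerDl scale1r opprD addNKr. Qed.

Lemma reflK i x : refl A i (refl A i x) = x.
Proof.
rewrite [X in refl A i X]/refl linearB linearZ /= refl_alpha /refl.
by apply/rowP => k; rewrite !mxE; ring.
Qed.

Lemma act_revK w x : act A (rev w) (act A w x) = x.
Proof. by elim: w => [//|i w IH]; rewrite rev_cons act_rcons act_cons reflK. Qed.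

Lemma actK_rev w x : act A w (act A (rev w) x) = x.
Proof. by rewrite -{1}(revK w) act_revK. Qed.

Lemma act_inj w : injective (@act R n A w).
Proof. exact: can_inj (act_revK w). Qed.

Lemma ip_act_rev w x y : B (act A w x) y = B x (act A (rev w) y).
Proof. by rewrite -(ip_act (rev w)) act_revK. Qed.

Definition halfnorm i : R := B (al i) (al i) / 2.
Local Notation d := halfnorm.

Lemma halfnorm_gt0 i : 0 < d i.
Proof. by rewrite divr_gt0 ?ip_gt0 ?alpha_neq0. Qed.

Lemma halfnorm_neq0 i : d i != 0.
Proof. by rewrite gt_eqF ?halfnorm_gt0. Qed.

Lemma div_halfnorm_ge0 (t : R) i : 0 <= t -> 0 <= t / d i.
Proof. by move=> t0; rewrite divr_ge0 // ltW // halfnorm_gt0. Qed.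

(** Compare [B x (al i)] with its image under s_i, which negates alpha_i: invariance alone
    determines these pairings. *)
Lemma ip_alphar x i : B x (al i) = x 0 i * d i.
Proof.
have h := ip_refl i x (al i).
rewrite refl_alpha /refl ipBl ipZl !BNr in h.
rewrite /d; lra.
Qed.

(* Since B(omega_i, alpha_j) = 0 for i <> j, this is the alpha_i-coordinate
   of x multiplied by the positive number d_i. *)
Definition root_coord i x : R := B (om i) x.
Local Notation zeta := root_coord.

Lemma root_coordZ i k x : zeta i (k *: x) = k * zeta i x.
Proof. exact: BZr. Qed.
Lemma root_coordN i x : zeta i (- x) = - zeta i x.
Proof. exact: BNr. Qed.
Lemma root_coordB i x y : zeta i (x - y) = zeta i x - zeta i y.
Proof. exact: BBr. Qed.
Lemma root_coordD i x y : zeta i (x + y) = zeta i x + zeta i y.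
Proof. exact: BDr. Qed.
Lemma root_coord0 i : zeta i 0 = 0.
Proof. by rewrite /zeta BC ip0l. Qed.

Lemma root_coord_alpha i j : zeta i (al j) = (i == j)%:R * d j.
Proof. by rewrite /zeta ip_alphar omegaE. Qed.

Lemma root_coord_alpha_id i : zeta i (al i) = d i.
Proof. by rewrite root_coord_alpha eqxx mul1r. Qed.

Lemma root_coord_refl i x : zeta i (refl A i x) = zeta i x - B x (al i).
Proof. by rewrite /refl root_coordB root_coordZ root_coord_alpha_id ip_alphar. Qed.

Lemma root_coord_refl_neq k i x : k != i -> zeta k (refl A i x) = zeta k x.
Proof.
by move=> ki; rewrite /refl root_coordB root_coordZ root_coord_alpha (negPf ki) mul0r
  mulr0 subr0.
Qed.

Lemma root_coord_act_notin k w x : k \notin w -> zeta k (act A w x) = zeta k x.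
Proof.
elim: w => [//|i w IH]; rewrite inE negb_or act_cons => /andP[ki /IH <-].
exact: root_coord_refl_neq.
Qed.

Lemma root_coord_eq0 x : (forall i, zeta i x = 0) -> x = 0.
Proof.
move=> h; apply: contraTeq isT => /ip_gt0.
rewrite {1}(row_sum_delta x) ip_suml big1 ?ltxx // => i _.
by rewrite ipZl [X in _ * X](h i) mulr0.
Qed.

Lemma root_coord_expand x : x = \sum_j (zeta j x / d j) *: al j.
Proof.
apply/eqP; rewrite -subr_eq0; apply/eqP/root_coord_eq0 => i.
rewrite root_coordB {2}/zeta (ip_sumr Gsym) (bigD1 i) //= big1.
  by rewrite addr0 BZr -/(zeta _ _) root_coord_alpha_id divfK ?halfnorm_neq0 ?subrr.
move=> j ji; rewrite BZr -/(zeta _ _) root_coord_alpha eq_sym (negPf ji).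
by rewrite mul0r mulr0.
Qed.

Lemma ip_alpha i j : B (al i) (al j) = (A j i)%:~R * d j.
Proof. by rewrite ip_alphar mxE. Qed.

Lemma ip_alpha_le0 i j : i != j -> B (al i) (al j) <= 0.
Proof.
case: HA => _ h _ ij; rewrite ip_alpha.
by rewrite mulr_le0_ge0 ?(ltW (halfnorm_gt0 _)) // lerz0 h // eq_sym.
Qed.

Lemma cartan_neq0C i j : (A i j != 0) = (A j i != 0).
Proof.
case: HA => _ _ h; apply/idP/idP; apply: contra => /eqP e; apply/eqP;
  by apply/h.
Qed.

Lemma ip_alpha_neq0 i j : (B (al i) (al j) != 0) = (A i j != 0).
Proof.
by rewrite ip_alpha mulf_eq0 (negPf (halfnorm_neq0 j)) orbF intr_eq0
  cartan_neq0C.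
Qed.

(** The cone spanned by the simple roots; on roots this is positivity. *)
Definition posv x := [forall i, 0 <= zeta i x].

Lemma posvP x : reflect (forall i, 0 <= zeta i x) (posv x).
Proof. exact: forallP. Qed.

Lemma posv_eq0 x : posv x -> posv (- x) -> x = 0.
Proof.
move=> /posvP h /posvP h'; apply: root_coord_eq0 => i; apply/eqP.
by rewrite eq_le h -oppr_ge0 -root_coordN h'.
Qed.

Lemma posv_alpha i : posv (al i).
Proof.
by apply/posvP => j; rewrite root_coord_alpha mulr_ge0 ?ler0n ?ltW ?halfnorm_gt0.
Qed.

Lemma posvD x y : posv x -> posv y -> posv (x + y).
Proof. by move=> /posvP h /posvP k; apply/posvP => i; rewrite root_coordD addr_ge0. Qed.

Lemma posvZ k x : 0 <= k -> posv x -> posv (k *: x).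
Proof. by move=> k0 /posvP h; apply/posvP => i; rewrite root_coordZ mulr_ge0. Qed.

Lemma posv_sum (I : finType) (P : pred I) (F : I -> 'rV[R]_n) :
  (forall i, P i -> posv (F i)) -> posv (\sum_(i | P i) F i).
Proof.
move=> h; elim/big_ind: _.
- by apply/posvP => i; rewrite root_coord0.
- by move=> x y; exact: posvD.
- exact: h.
Qed.

Lemma act_negv w x : (forall i, posv (- act A w (al i))) -> posv x ->
  posv (- act A w x).
Proof.
move=> h /posvP px; rewrite (root_coord_expand x) linear_sum -sumrN.
apply: posv_sum => i _; rewrite linearZ -scalerN; apply: posvZ; last exact: h.
by rewrite div_halfnorm_ge0 ?px.
Qed.

(** Distinct simple roots pair nonpositively, and the alpha_j-term of x contributes strictly. *)
Lemma ip_alpha_lt0 x i j : posv x -> zeta i x = 0 -> 0 < zeta j x ->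
  A i j != 0 -> B x (al i) < 0.
Proof.
move=> /posvP px zi zj Aij.
have ji : j != i by apply: contraTneq zj => ->; rewrite zi ltxx.
rewrite (root_coord_expand x) ip_suml (bigD1 j) //=.
have t_le0 k : k != i -> B ((zeta k x / d k) *: al k) (al i) <= 0.
  move=> ki; rewrite ipZl mulr_ge0_le0 ?ip_alpha_le0 //.
  by rewrite div_halfnorm_ge0 ?px.
rewrite -[ltRHS]addr0 ltr_leD //.
  rewrite ipZl pmulr_rlt0 ?(divr_gt0 zj (halfnorm_gt0 _)) //.
  by rewrite lt_neqAle ip_alpha_le0 // ip_alpha_neq0 cartan_neq0C Aij.
apply: sumr_le0 => k _; have [->|/t_le0//] := eqVneq k i.
by rewrite zi mul0r scale0r ip0l.
Qed.

(** * Roots and reduced words *)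

Definition isroot x := exists w i, x = act A w (al i).

Lemma isroot_alpha i : isroot (al i).
Proof. by exists [::], i. Qed.

Lemma isroot_act w x : isroot x -> isroot (act A w x).
Proof. by case=> v [i ->]; exists (w ++ v), i; rewrite act_cat. Qed.

Lemma isrootN x : isroot x -> isroot (- x).
Proof.
case=> w [i ->]; exists (rcons w i), i.
by rewrite act_rcons refl_alpha linearN.
Qed.

Lemma isroot_neq0 x : isroot x -> x != 0.
Proof.
case=> w [i ->]; apply: contra_neq (alpha_neq0 i) => h.
by rewrite -[LHS](act_revK w) h linear0.
Qed.

Lemma coordE x k : x 0 k = \sum_j (zeta j x / d j) * (A k j)%:~R.
Proof.
rewrite {1}(root_coord_expand x) summxE; apply: eq_bigr => j _.
by rewrite !mxE.
Qed.

(* [zeta j x / d j] is the coordinate of x on alpha_j, and [zeta j x / d i]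
   the coordinate of the coroot of x, when x is conjugate to alpha_i. *)
Definition integral i x :=
  (forall j, zeta j x / d j \is a Num.int) /\
  (forall j, zeta j x / d i \is a Num.int).

(** A simple reflection changes one coordinate, by an integer combination of the others with Cartan
    integers as coefficients. *)
Lemma root_integral w i : integral i (act A w (al i)).
Proof.
elim: w => [|k w [IH1 IH2]].
  split=> j; rewrite root_coord_alpha; have [e|_] := eqVneq j i;
    by rewrite ?e ?mul0r ?mul1r ?divff ?halfnorm_neq0 ?rpred0 ?rpred1.
rewrite act_cons; set x := act A w (al i) in IH1 IH2 *.
split=> j; (have [->|jk] := eqVneq j k; last by rewrite root_coord_refl_neq);
    rewrite root_coord_refl mulrBl rpredB //.
  rewrite ip_alphar mulfK ?halfnorm_neq0 // coordE.
  by apply: rpred_sum => l _; rewrite rpredM ?intr_int.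
rewrite (root_coord_expand x) ip_suml mulr_suml; apply: rpred_sum => l _.
rewrite ipZl BC ip_alpha mulrCA divfK ?halfnorm_neq0 // -mulrA.
by rewrite rpredM ?intr_int.
Qed.

(* B x x = 2 d_i for a root x, and splitting x into its positive and negative
   parts would give two nonzero vectors of norm at least 2 d_i each. *)
Lemma part_even i x (Q : pred 'I_n) : integral i x ->
  let y := \sum_(j | Q j) (zeta j x / d j) *: al j in
  (forall k, y 0 k \is a Num.int) /\ B y y / (2 * d i) \is a Num.int.
Proof.
move=> [I1 I2] /=.
elim/big_rec: _ => [|k y _ [IH1 IH2]].
  by split=> [k|]; rewrite ?mxE ?ip0l ?mul0r rpred0.
split=> [l|]; first by rewrite !mxE rpredD // rpredM ?intr_int.
set t := zeta k x / d k.
have -> : B (t *: al k + y) (t *: al k + y) =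
    2 * (d k * t) * t + 2 * (d k * t) * y 0 k + B y y.
  rewrite ipDl !BDr !ipZl !BZr (BC (al k) y) !ip_alphar alpha_diag.
  by ring.
have -> : d k * t = zeta k x by rewrite /t mulrC divfK ?halfnorm_neq0.
have -> : (2 * zeta k x * t + 2 * zeta k x * y 0 k + B y y) / (2 * d i) =
    zeta k x / d i * t + zeta k x / d i * y 0 k + B y y / (2 * d i).
  by field; exact: halfnorm_neq0.
by rewrite !rpredD //; apply: rpredM => //; exact: I1.
Qed.

Lemma int_ge1 (t : R) : t \is a Num.int -> 0 < t -> 1 <= t.
Proof. by move=> /intrP[m ->]; rewrite ltr0z ler1z. Qed.

Lemma root_posv x : isroot x -> posv x || posv (- x).
Proof.
case=> w [i xE]; have Ix : integral i x by rewrite xE; exact: root_integral.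
pose Q := [pred j | 0 < zeta j x].
pose P := \sum_(j | Q j) (zeta j x / d j) *: al j.
pose N := \sum_(j | ~~ Q j) (zeta j x / d j) *: al j.
have xPN : x = P + N by rewrite {1}(root_coord_expand x) (bigID Q).
have Bx : B x x = 2 * d i by rewrite xE ip_act /d mulrC divfK // pnatr_eq0.
have big (S : pred 'I_n) : let y := \sum_(j | S j) (zeta j x / d j) *: al j in
    y != 0 -> 2 * d i <= B y y.
  move=> y y0; have [_ /int_ge1] := part_even S Ix.
  have d2 : 0 < 2 * d i by rewrite mulr_gt0 ?ltr0n ?halfnorm_gt0.
  by rewrite divr_gt0 ?ip_gt0 // ler_pdivlMr // mul1r; exact.
(* The coefficients in P and N have opposite signs and the simple roots involved are distinct. *)
have PN : 0 <= B P N.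
  rewrite ip_suml sumr_ge0 // => j Qj; rewrite (ip_sumr Gsym) sumr_ge0 // => k Qk.
  rewrite ipZl BZr; apply: mulr_ge0; first by rewrite div_halfnorm_ge0 // ltW.
  apply: mulr_le0; last by rewrite ip_alpha_le0 //; apply: contraNneq Qk => <-.
  by rewrite -oppr_ge0 -mulNr div_halfnorm_ge0 // oppr_ge0 leNgt.
have [P0|P0] := eqVneq P 0.
  apply/orP; right; rewrite xPN P0 add0r -sumrN; apply: posv_sum => j Qj.
  rewrite -scaleNr; apply: posvZ; last exact: posv_alpha.
  by rewrite -mulNr div_halfnorm_ge0 // oppr_ge0 leNgt.
have [N0|N0] := eqVneq N 0.
  apply/orP; left; rewrite xPN N0 addr0; apply: posv_sum => j Qj.
  apply: posvZ; last exact: posv_alpha.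
  by rewrite div_halfnorm_ge0 // ltW.
have hP : 2 * d i <= B P P := big _ P0.
have hN : 2 * d i <= B N N := big _ N0.
have := halfnorm_gt0 i; move: Bx; rewrite xPN ipDl !BDr (BC N P); lra.
Qed.

Lemma root_negE x : isroot x -> posv (- x) = ~~ posv x.
Proof.
move=> rx; have := root_posv rx; case px: (posv x) => //= _.
by apply/negP => /(posv_eq0 px); apply/eqP; exact: isroot_neq0.
Qed.

Lemma root_posv_zeta x i : isroot x -> 0 < zeta i x -> posv x.
Proof.
move=> /root_posv/orP[//|/posvP/(_ i)].
by rewrite root_coordN oppr_ge0 => h /lt_le_trans/(_ h); rewrite ltxx.
Qed.

(** Both t and its inverse are integers: the inverse word sends alpha_j to [t^-1 *: al i]. *)
Lemma root_multiple t j : isroot (t *: al j) -> 0 < t -> t = 1.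
Proof.
case=> w [i e] t0; apply/eqP; rewrite eq_le; apply/andP; split; last first.
  apply: int_ge1 => //; have [+ _] := root_integral w i => /(_ j).
  by rewrite -e root_coordZ root_coord_alpha_id mulfK ?halfnorm_neq0.
have e' : act A (rev w) (al j) = t^-1 *: al i.
  by rewrite -(act_revK w (al i)) -e linearZ /= scalerA mulVf ?gt_eqF // scale1r.
rewrite -[leRHS]invr1 -[t]invrK lef_pV2 ?posrE ?invr_gt0 ?ltr01 //.
apply: int_ge1; rewrite ?invr_gt0 //.
have [+ _] := root_integral (rev w) j => /(_ i).
by rewrite e' root_coordZ root_coord_alpha_id mulfK ?halfnorm_neq0.
Qed.

(** s_j alters only the alpha_j-coordinate, so all other coordinates of x must vanish. *)
Lemma refl_neg_root x j : isroot x -> posv x -> ~~ posv (refl A j x) ->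
  x = al j.
Proof.
move=> rx px; rewrite -root_negE; last exact: (isroot_act [:: j]).
move=> /posvP nx; have z k : k != j -> zeta k x = 0.
  move=> kj; apply/eqP; rewrite eq_le; move/posvP/(_ k): px => ->.
  by move: (nx k); rewrite root_coordN root_coord_refl_neq // oppr_ge0 => ->.
have xE : x = (zeta j x / d j) *: al j.
  rewrite {1}(root_coord_expand x) (bigD1 j) //= big1 ?addr0 // => k /z ->.
  by rewrite mul0r scale0r.
have t0 : 0 < zeta j x / d j.
  rewrite lt_neqAle div_halfnorm_ge0 ?(posvP _ px) // andbT.
  by apply: contraTneq (isroot_neq0 rx) => t0; rewrite xE -t0 scale0r eqxx.
by rewrite xE (@root_multiple _ j _ t0) ?scale1r // -xE.
Qed.

(** For w = s_1 ... s_k these are the roots s_1 ... s_(m-1) alpha_m, in order; for reduced w they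
    are the positive roots made negative by w^-1. *)
Fixpoint roots w : seq 'rV[R]_n :=
  if w is i :: w' then al i :: map (refl A i) (roots w') else [::].

Lemma roots_rcons w j : roots (rcons w j) = rcons (roots w) (act A w (al j)).
Proof. by elim: w => [//|i w IH] /=; rewrite IH map_rcons. Qed.

Lemma size_roots w : size (roots w) = size w.
Proof. by elim: w => [//|i w IH] /=; rewrite size_map IH. Qed.

Lemma mem_roots w x :
  x \in roots w -> exists w1 j w2, w = w1 ++ j :: w2 /\ x = act A w1 (al j).
Proof.
elim/last_ind: w => [//|w j IH]; rewrite roots_rcons mem_rcons inE.
case/orP => [/eqP ->|/IH[w1 [k [w2 [-> ->]]]]].
  by exists w, j, [::]; rewrite cats1.
by exists w1, k, (rcons w2 j); rewrite -rcons_cons -rcons_cat.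
Qed.

Definition rword w := all posv (roots w).

Lemma rword_rcons w j : rword (rcons w j) = posv (act A w (al j)) && rword w.
Proof. by rewrite /rword roots_rcons all_rcons. Qed.

Lemma rword_catl u v : rword (u ++ v) -> rword u.
Proof.
elim/last_ind: v => [|v j IH]; first by rewrite cats0.
by rewrite -rcons_cat rword_rcons => /andP[_ /IH].
Qed.

(** Applying the letters one at a time, x changes sign somewhere, and there it has become a simple
    root. *)
Lemma mem_roots_neg w x : isroot x -> posv x ->
  ~~ posv (act A (rev w) x) -> x \in roots w.
Proof.
move=> rx px; elim/last_ind: w => [|w j IH]; first by rewrite px.
rewrite rev_rcons act_cons roots_rcons mem_rcons inE.
case: (boolP (posv (act A (rev w) x))) => [pe|/IH -> _]; last by rewrite orbT.
move=> /(refl_neg_root (isroot_act _ rx) pe) <-.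
by rewrite actK_rev eqxx.
Qed.

(** In a reduced word the sign cannot change back: -x would then be one of the positive roots of the
    word. *)
Lemma mem_rootsE w x : rword w -> isroot x -> posv x ->
  (x \in roots w) = ~~ posv (act A (rev w) x).
Proof.
move=> rw rx px; apply/idP/idP; last exact: mem_roots_neg.
elim/last_ind: w rw => [//|w j IH].
rewrite rword_rcons => /andP[pj rw]; rewrite roots_rcons mem_rcons inE.
rewrite rev_rcons act_cons => /orP[/eqP ->|/(IH rw) nx].
  by rewrite act_revK refl_alpha root_negE ?posv_alpha //; exact: isroot_alpha.
apply/negP => ps; have nE : - act A (rev w) x = al j.
  apply: refl_neg_root; first by apply/isrootN/isroot_act.
    by rewrite root_negE //; exact: isroot_act.
  by rewrite linearN root_negE ?ps //; exact: (isroot_act (j :: _)).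
move: pj; rewrite -nE linearN /= actK_rev => /(posv_eq0 px).
by apply/eqP/isroot_neq0.
Qed.

Lemma roots_uniq w : rword w -> uniq (roots w).
Proof.
elim/last_ind: w => [//|w j IH]; rewrite rword_rcons => /andP[pj rw].
rewrite roots_rcons rcons_uniq IH // andbT mem_rootsE //.
  by rewrite act_revK posv_alpha.
by apply/isroot_act/isroot_alpha.
Qed.

Lemma weq_rev u v : weq R A u v -> weq R A (rev u) (rev v).
Proof.
by move=> uv x; apply: (@act_inj u); rewrite actK_rev uv actK_rev.
Qed.

(** The roots of w are distinct inversions, and each must occur in [roots v] for any word v of the
    same element. *)
Lemma rword_reduced w : rword w -> reduced R A w.
Proof.
move=> rw v vw; rewrite -!size_roots; apply: uniq_leq_size.
  exact: roots_uniq.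
move=> x xw; have rx : isroot x.
  by case/mem_roots: (xw) => w1 [j [w2 [_ ->]]]; apply/isroot_act/isroot_alpha.
have px : posv x by move/allP: rw => /(_ x xw).
by apply: mem_roots_neg => //; rewrite (weq_rev vw) -mem_rootsE.
Qed.

Lemma refl_conj w i j x :
  act A w (al i) = al j -> act A w (refl A i x) = refl A j (act A w x).
Proof.
move=> e; rewrite /refl linearB linearZ /= e; congr (_ - _ *: _).
have dd : d i = d j by rewrite /halfnorm -e ip_act.
apply: (mulIf (halfnorm_neq0 i)).
by rewrite -ip_alphar -(ip_act w) e ip_alphar dd.
Qed.

Lemma exchange w i : ~~ posv (act A w (al i)) ->
  exists w1 j w2, w = w1 ++ j :: w2 /\ act A w2 (al i) = al j.
Proof.
elim: w => [|j w IH]; first by rewrite posv_alpha.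
case: (boolP (posv (act A w (al i)))) => [pw nw|/IH].
  exists [::], j, w; split=> //; apply: refl_neg_root => //.
  by apply/isroot_act/isroot_alpha.
by move=> [w1 [k [w2 [-> e]]]] _; exists (j :: w1), k, w2.
Qed.

(** Exchange condition: by [refl_conj] the last letter cancels against the letter k. *)
Lemma shorten w : ~~ rword w ->
  exists2 v, weq R A v w & (size v < size w)%N.
Proof.
elim/last_ind: w => [//|w j IH]; rewrite rword_rcons negb_and.
case/orP => [/exchange[w1 [k [w2 [-> e]]]]|/IH[v vw sv]]; last first.
  by exists (rcons v j); rewrite ?size_rcons // => x; rewrite !act_rcons vw.
exists (w1 ++ w2); last by rewrite size_rcons !size_cat /= addnS ltnS leqnSn.
by move=> x; rewrite act_rcons !act_cat act_cons (refl_conj _ e) reflK.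
Qed.

Lemma reduced_rword w : reduced R A w -> rword w.
Proof.
by move=> h; apply: contraT => /shorten[v /h]; rewrite leqNgt => /negPf ->.
Qed.

Lemma rword_exists w : exists2 v, weq R A v w & rword v.
Proof.
have [m] := ubnP (size w); elim: m w => [//|m IH] w; rewrite ltnS => sw.
case: (boolP (rword w)) => [rw|/shorten[v vw sv]]; first by exists w.
by case: (IH v (leq_trans sv sw)) => v' e r; exists v' => // x; rewrite e.
Qed.

Lemma rword_rev w : rword w -> rword (rev w).
Proof.
move=> /rword_reduced rw; apply: reduced_rword => v /weq_rev; rewrite revK.
by move=> /rw; rewrite !size_rev.
Qed.

Lemma rword_catr u v : rword (u ++ v) -> rword v.
Proof.
by move=> /rword_rev; rewrite rev_cat => /rword_catl/rword_rev; rewrite revK.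
Qed.

Lemma longest_negv w0 i : longest R A w0 -> posv (- act A w0 (al i)).
Proof.
case=> /reduced_rword rw h; rewrite root_negE; last by apply/isroot_act/isroot_alpha.
apply/negP => p; have /rword_reduced/h : rword (rcons w0 i).
  by rewrite rword_rcons p.
by rewrite size_rcons ltnn.
Qed.

(** If a reduced word of u^-1 w0 ended in i, u would map a positive root to - w0 alpha_i, which is
    positive. *)
Lemma longest_unique w0 u : longest R A w0 ->
  (forall i, posv (- act A u (al i))) -> weq R A u w0.
Proof.
move=> L nu; have [v vE rv] := rword_exists (rev u ++ w0).
case/lastP: v => [|v i] in vE rv *.
  by move=> x; rewrite -[in RHS](actK_rev u (act A w0 x)) -(act_cat A (rev u)) -vE.
move: rv; rewrite rword_rcons => /andP[pv _].
have e : act A u (act A v (al i)) = - act A w0 (al i).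
  rewrite -[in RHS](actK_rev u (act A w0 (al i))) -(act_cat A (rev u)) -vE act_rcons.
  by rewrite refl_alpha !linearN /= opprK.
have := act_negv nu pv; rewrite e => /(posv_eq0 (longest_negv i L))/eqP.
by rewrite oppr_eq0 (negPf (isroot_neq0 (isroot_act _ (isroot_alpha _)))).
Qed.

Lemma act_longest_negv w0 x : longest R A w0 -> posv x ->
  posv (- act A w0 x).
Proof. by move=> L; apply: act_negv => i; exact: longest_negv. Qed.

Lemma longest_rev w0 : longest R A w0 -> weq R A (rev w0) w0.
Proof.
move=> L; apply: longest_unique => // i.
have r : isroot (act A (rev w0) (al i)) by apply/isroot_act/isroot_alpha.
rewrite root_negE //; apply/negP => /(act_longest_negv L).
rewrite actK_rev => /(posv_eq0 (posv_alpha i))/eqP.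
by rewrite (negPf (alpha_neq0 i)).
Qed.

Lemma longestK w0 x : longest R A w0 -> act A w0 (act A w0 x) = x.
Proof. by move=> L; rewrite -{1}(longest_rev L) act_revK. Qed.

(** * Coxeter elements *)

Definition cword (cw : seq 'I_n) m := flatten (nseq m cw).

Lemma cpowE cw m x : cpow A cw m x = act A (cword cw m) x.
Proof. by elim: m => [//|m IH]; rewrite act_cat -IH. Qed.

Lemma cpowD cw m k x : cpow A cw (m + k) x = cpow A cw m (cpow A cw k x).
Proof. exact: iterD. Qed.

Lemma ip_cpow cw m x y : B (cpow A cw m x) (cpow A cw m y) = B x y.
Proof. by rewrite !cpowE ip_act. Qed.

Lemma cpowN cw m x : cpow A cw m (- x) = - cpow A cw m x.
Proof. by rewrite !cpowE linearN. Qed.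

Lemma act_fixed cw x : uniq cw -> act A cw x = x -> forall i, i \in cw -> x 0 i = 0.
Proof.
elim: cw => [//|s c IH] /= /andP[sc uc] e.
have e' : act A c x = refl A s x by rewrite -[in RHS]e reflK.
have xs : x 0 s = 0.
  have := root_coord_act_notin x sc; rewrite e' root_coord_refl ip_alphar => h.
  have : x 0 s * d s = 0 by lra.
  by move/eqP; rewrite mulf_eq0 (negPf (halfnorm_neq0 s)) orbF => /eqP.
move=> i; rewrite inE => /orP[/eqP -> //|]; apply: IH => //.
by rewrite e' /refl xs scale0r subr0.
Qed.

Section CoxeterElement.
Variable cw : seq 'I_n.
Hypothesis Hcw : coxeter_word cw.

Lemma coxeter_uniq : uniq cw.
Proof. by rewrite (perm_uniq Hcw) enum_uniq. Qed.

Lemma mem_coxeter i : i \in cw.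
Proof. by rewrite (perm_mem Hcw) mem_enum. Qed.

Lemma size_coxeter : size cw = n.
Proof. by rewrite (perm_size Hcw) size_enum_ord. Qed.

Lemma coxeter_word_rev : coxeter_word (rev cw).
Proof. by rewrite /coxeter_word perm_rev. Qed.

Lemma coxeter_fixed x : act A cw x = x -> x = 0.
Proof.
move=> e; apply/rowP => i; rewrite mxE.
exact: (act_fixed coxeter_uniq e (mem_coxeter i)).
Qed.

Lemma coxeter_split i : exists u v,
  [/\ cw = u ++ i :: v, i \notin u & i \notin v].
Proof.
have := coxeter_uniq; case/splitPr: (mem_coxeter i) => x z.
by rewrite cat_uniq /= negb_or => /and3P[_ /andP[ix _] /andP[iz _]]; exists x, z.
Qed.

Lemma coxeter_omega u i v : cw = u ++ i :: v ->
  omega R i - act A cw (omega R i) = act A u (al i).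
Proof.
move=> e; have := coxeter_uniq.
rewrite e cat_uniq /= negb_or => /and3P[_ /andP[iu _] /andP[iv _]].
rewrite act_cat act_cons act_omega_notin // refl_omega linearB /=.
by rewrite (act_omega_notin _ _ iu) subKr.
Qed.

(** The root of c^oo at the occurrence of i in copy m of c, counted from 0; see
    [uword_predT_alpha]. *)
Definition beta i m : 'rV[R]_n :=
  cpow A cw m (omega R i) - cpow A cw m.+1 (omega R i).

Lemma betaD i m k : beta i (m + k) = cpow A cw m (beta i k).
Proof. by rewrite /beta -addnS !cpowD !cpowE linearB. Qed.

Lemma beta0E u i v : cw = u ++ i :: v -> beta i 0 = act A u (al i).
Proof. by move=> e; rewrite /beta /= (coxeter_omega e). Qed.

Lemma isroot_beta i m : isroot (beta i m).
Proof.
have [x [z [e _ _]]] := coxeter_split i.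
rewrite -[m]addn0 betaD (beta0E e) cpowE.
by do 2!apply: isroot_act; exact: isroot_alpha.
Qed.

Lemma posv_beta0 i : posv (beta i 0).
Proof.
have [x [z [e ix _]]] := coxeter_split i.
apply: (@root_posv_zeta _ i); first exact: isroot_beta.
by rewrite (beta0E e) root_coord_act_notin // root_coord_alpha_id halfnorm_gt0.
Qed.

(* The positive roots made negative by c are the inversions of the word c. *)
Lemma coxeter_descent x : isroot x -> posv x -> ~~ posv (act A cw x) ->
  exists j, act A cw x = - beta j 0.
Proof.
move=> rx px; rewrite -{1}[cw]revK => /(mem_roots_neg rx px).
move/mem_roots => [w1 [j [w2 [e ->]]]]; exists j.
have cE : cw = rev w2 ++ j :: rev w1.
  by rewrite -[LHS]revK e rev_cat rev_cons cat_rcons.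
by rewrite (beta0E cE) {1}cE act_cat act_cons act_revK refl_alpha linearN.
Qed.

Lemma first_neg_beta i m : (forall k, (k < m)%N -> posv (beta i k)) ->
  ~~ posv (beta i m) -> exists j, cpow A cw m (omega R i) = - omega R j.
Proof.
case: m => [|m] h; first by rewrite posv_beta0.
(* The first negative root is -(1 - c) omega_j for some j, so c fixes c^m omega_i + omega_j, which
   is therefore 0. *)
have bS : beta i m.+1 = act A cw (beta i m) by rewrite -[m.+1]add1n betaD.
move=> nb; rewrite bS in nb.
have [j jE] := coxeter_descent (isroot_beta i m) (h m (ltnSn m)) nb.
exists j; apply/eqP; rewrite -addr_eq0; apply/eqP/coxeter_fixed/esym/eqP.
rewrite -subr_eq0 linearD /= opprD addrACA.
by rewrite -/(cpow A cw m.+2 _) -/(beta i m.+1) bS jE addNr.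
Qed.

Definition before (i j : 'I_n) := (index i cw < index j cw)%N.

Lemma before_split i j : before i j ->
  exists u v w, cw = u ++ i :: v ++ j :: w.
Proof.
have [x [z [e ix _]]] := coxeter_split j; rewrite /before {1 2}e => ij.
have ii : i \in x.
  move: ij; rewrite !index_cat (negPf ix) /= eqxx addn0.
  by case: ifP => // _; rewrite ltnNge leq_addr.
by case/splitPr: ii e => x1 x2 ->; exists x1, x2, z; rewrite -catA.
Qed.

Lemma before_notin u i v j w : cw = u ++ i :: v ++ j :: w ->
  [/\ j \notin u, i \notin u, i \notin v, j \notin v & (i \notin w) && (i != j)].
Proof.
move=> e; have := coxeter_uniq; rewrite e cat_uniq /= mem_cat inE.
rewrite cat_uniq /= !negb_or has_cat /= !negb_or.
move=> /and3P[_ /and3P[-> _ /andP[-> _]]].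
by move=> /andP[/and3P[-> -> ->] /and3P[_ /andP[-> _] _]].
Qed.

Lemma before_beta0 i j : before i j -> zeta j (beta i 0) = 0.
Proof.
case/before_split => x [y [z e]]; have [jx _ _ _ /andP[_ ij]] := before_notin e.
by rewrite (beta0E e) root_coord_act_notin // root_coord_alpha eq_sym (negPf ij) mul0r.
Qed.

(** s_i meets a positive root involving alpha_j but not alpha_i, so it creates a positive
    alpha_i-coordinate, which the earlier letters preserve. *)
Lemma root_coord_beta0_gt0 i j : before i j -> A i j != 0 -> 0 < zeta i (beta j 0).
Proof.
case/before_split => x [y [z e]] Aij; have [jx ix iy jy /andP[_ ij]] := before_notin e.
have e' : cw = (x ++ i :: y) ++ j :: z by rewrite e -catA.
rewrite (beta0E e') act_cat act_cons root_coord_act_notin // root_coord_refl.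
have zi : zeta i (act A y (al j)) = 0.
  by rewrite root_coord_act_notin // root_coord_alpha (negPf ij) mul0r.
have zj : 0 < zeta j (act A y (al j)).
  by rewrite root_coord_act_notin // root_coord_alpha_id halfnorm_gt0.
rewrite zi sub0r oppr_gt0; apply: (ip_alpha_lt0 _ zi zj Aij).
by apply: (root_posv_zeta _ zj); apply/isroot_act/isroot_alpha.
Qed.

(** Here s_j is the reflection creating the coordinate, within the next copy of c. *)
Lemma root_coord_beta1_gt0 i j : before i j -> A i j != 0 -> 0 < zeta j (beta i 1).
Proof.
case/before_split => x [y [z e]] Aij; have [jx ix iy jy /andP[iz ij]] := before_notin e.
have e' : cw = (x ++ i :: y) ++ j :: z by rewrite e -catA.
have jz : j \notin z.
  by have := coxeter_uniq; rewrite e' cat_uniq /= => /and3P[_ _ /andP[]].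
rewrite -[1%N]addn0 betaD (beta0E e) /cpow /= e' act_cat act_cons.
rewrite root_coord_act_notin; last by rewrite mem_cat inE !negb_or jx eq_sym ij.
rewrite root_coord_refl -!act_cat.
have zi : 0 < zeta i (act A (z ++ x) (al i)).
  rewrite root_coord_act_notin ?root_coord_alpha_id ?halfnorm_gt0 //.
  by rewrite mem_cat negb_or iz.
have zj : zeta j (act A (z ++ x) (al i)) = 0.
  rewrite root_coord_act_notin ?mem_cat ?negb_or ?jz //.
  by rewrite root_coord_alpha eq_sym (negPf ij) mul0r.
rewrite zj sub0r oppr_gt0; apply: (ip_alpha_lt0 _ zj zi).
  by apply: (root_posv_zeta _ zi); apply/isroot_act/isroot_alpha.
by rewrite cartan_neq0C.
Qed.

Lemma beforeP i j : i != j -> before i j = ~~ before j i.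
Proof.
move=> ij; rewrite /before -leqNgt [RHS]leq_eqVlt; case: eqP => // e.
by move: ij; rewrite -(nth_index i (mem_coxeter i)) e nth_index ?mem_coxeter ?eqxx.
Qed.

(** * Words cut out of the infinite power of a Coxeter word *)

Section Positions.
Variable i0 : 'I_n.

(** [i0] is the default of [nth]; its existence also gives 0 < n. *)
Definition letter p := nth i0 cw (p %% n).

Lemma rank_gt0 : (0 < n)%N. Proof. exact: leq_ltn_trans (ltn_ord i0). Qed.

Lemma lettersE ps : letters cw ps = map letter ps.
Proof.
elim: ps => [//|p ps IH]; rewrite /letters /= -/(letters cw ps) IH.
have : onth cw (p %% size cw) by rewrite onthTE ltn_mod size_coxeter rank_gt0.
case e: (onth _ _) => [i|//] _ /=.
by rewrite -(@onth_nth _ i0 _ _ _ e) size_coxeter.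
Qed.

Definition pos i m := (m * n + index i cw)%N.

Lemma index_lt i : (index i cw < n)%N.
Proof. by rewrite -[X in (_ < X)%N]size_coxeter index_mem mem_coxeter. Qed.

Lemma letter_pos i m : letter (pos i m) = i.
Proof. by rewrite /letter modnMDl modn_small ?index_lt // nth_index ?mem_coxeter. Qed.

Lemma pos_div i m : (pos i m %/ n = m)%N.
Proof. by rewrite divnMDl ?rank_gt0 // divn_small ?addn0 ?index_lt. Qed.

Lemma index_letter p : index (letter p) cw = (p %% n)%N.
Proof. by rewrite index_uniq ?coxeter_uniq // size_coxeter ltn_mod rank_gt0. Qed.

Lemma pos_letter p : pos (letter p) (p %/ n) = p.
Proof. by rewrite /pos index_letter -divn_eq. Qed.

Lemma letterD m p : letter (m * n + p) = letter p.
Proof. by rewrite /letter modnMDl. Qed.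

Definition uword (S : pred nat) P := [seq letter p | p <- iota 0 P & S p].

Lemma uwordS S P :
  uword S P.+1 = if S P then rcons (uword S P) (letter P) else uword S P.
Proof.
rewrite /uword -addn1 iotaD filter_cat map_cat /=.
by case: ifP; rewrite ?cats0 ?cats1.
Qed.

Lemma uword_predT_small r : (r <= n)%N -> uword predT r = take r cw.
Proof.
rewrite /uword filter_predT => rn; apply: (@eq_from_nth _ i0).
  by rewrite size_map size_iota size_takel ?size_coxeter.
move=> i; rewrite size_map size_iota => ir.
rewrite (nth_map 0%N) ?size_iota // nth_iota // nth_take // /letter modn_small //.
exact: leq_trans ir rn.
Qed.

Lemma uword_predTD m r : uword predT (m * n + r) = cword cw m ++ uword predT r.
Proof.
elim: m => [//|m IH]; rewrite mulSn -addnA /uword filter_predT iotaD map_cat.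
rewrite /cword /= -catA -IH /uword !filter_predT; congr (_ ++ _).
  have := uword_predT_small (leqnn n).
  by rewrite /uword filter_predT take_oversize // size_coxeter.
rewrite add0n -[X in iota X]addn0 iotaDl -map_comp.
by apply: eq_map => p /=; rewrite -[n in (n + p)%N]mul1n letterD.
Qed.

Lemma count_cword l m : count_mem l (cword cw m) = m.
Proof.
elim: m => [//|m IH]; rewrite /cword /= count_cat -/(cword cw m) IH.
by rewrite count_uniq_mem ?coxeter_uniq // mem_coxeter.
Qed.

(** Letters other than l fix omega_l, so an incomplete last copy of c acts on it as c or trivially,
    according to whether it contains l. *)
Lemma uword_predT_omega P l :
  act A (uword predT P) (omega R l) =
  cpow A cw (count_mem l (uword predT P)) (omega R l).
Proof.
rewrite (divn_eq P n) uword_predTD act_cat -cpowE count_cat count_cword cpowD.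
have Pn : (P %% n <= n)%N by rewrite ltnW // ltn_mod rank_gt0.
congr (cpow A cw _ _); rewrite uword_predT_small //.
rewrite count_uniq_mem ?take_uniq ?coxeter_uniq //.
set r := (P %% n)%N; have := coxeter_uniq; rewrite -{1}(cat_take_drop r cw).
rewrite cat_uniq => /and3P[_ /hasPn h _].
case: (boolP (l \in take r cw)) => lr /=; last by rewrite act_omega_notin.
have ld : l \notin drop r cw by apply: contraL lr => /h.
by rewrite -[in RHS](cat_take_drop r cw) act_cat (act_omega_notin _ _ ld).
Qed.

Lemma count_letter p : count_mem (letter p) (uword predT p) = (p %/ n)%N.
Proof.
rewrite {2}(divn_eq p n) uword_predTD count_cat count_cword.
rewrite uword_predT_small ?count_uniq_mem ?take_uniq ?coxeter_uniq //; last first.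
  by rewrite ltnW // ltn_mod rank_gt0.
case: (boolP (_ \in _)) => [|_]; last by rewrite addn0.
move=> /index_ltn; rewrite index_letter; first by rewrite ltnn.
Qed.

Lemma uword_predT_alpha p :
  act A (uword predT p) (al (letter p)) = beta (letter p) (p %/ n).
Proof.
have := uword_predT_omega p.+1 (letter p).
rewrite uwordS /= act_rcons refl_omega linearB /= uword_predT_omega.
rewrite -cats1 count_cat /= eqxx addn0 addn1 count_letter /beta => <-.
by rewrite subKr.
Qed.

(* An order ideal of the heap of c^oo: two occurrences of letters that do not
   commute are ordered by their positions. *)
Definition ideal (S : pred nat) := forall q p, (q < p)%N -> S p ->
  A (letter q) (letter p) != 0 -> S q.

Lemma ideal_count S p l : ideal S -> S p -> A l (letter p) != 0 ->
  count_mem l (uword S p) = count_mem l (uword predT p).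
Proof.
move=> iS Sp Al; rewrite /uword filter_predT !count_map count_filter.
apply: eq_in_count => q; rewrite mem_iota add0n /= => qp.
by case: eqP => //= e; rewrite (iS q p) // e.
Qed.

(** Only neighbours l of the letter contribute to its simple root, and before p the ideal omits none
    of their occurrences, so the full prefix of c^oo gives the same value. *)
Lemma ideal_alpha S p : ideal S -> S p ->
  (forall l, act A (uword S p) (omega R l) =
     cpow A cw (count_mem l (uword S p)) (omega R l)) ->
  act A (uword S p) (al (letter p)) = beta (letter p) (p %/ n).
Proof.
move=> iS Sp h; rewrite -uword_predT_alpha (alpha_sum R A) !linear_sum.
apply: eq_bigr => l _; rewrite !linearZ /=.
have [->|Al] := eqVneq (A l (letter p)) 0; first by rewrite !scale0r.
by rewrite h uword_predT_omega ideal_count.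
Qed.

Lemma ideal_omega S P l : ideal S ->
  act A (uword S P) (omega R l) =
  cpow A cw (count_mem l (uword S P)) (omega R l).
Proof.
move=> iS; elim: P l => [//|P IH] l; rewrite uwordS; case: ifP => // SP.
rewrite act_rcons -cats1 count_cat /= addn0.
have [<-|e] := eqVneq (letter P) l; last by rewrite refl_omega_neq // addn0.
rewrite refl_omega linearB /= ideal_alpha // IH ideal_count //; last first.
  by case: HA => -> _ _.
by rewrite count_letter /beta subKr addn1.
Qed.

Lemma ideal_root S p : ideal S -> S p ->
  act A (uword S p) (al (letter p)) = beta (letter p) (p %/ n).
Proof. by move=> iS Sp; apply: ideal_alpha => // l; exact: ideal_omega. Qed.

Lemma ideal_rword S P : ideal S ->
  (forall p, S p -> posv (beta (letter p) (p %/ n))) -> rword (uword S P).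
Proof.
move=> iS h; elim: P => [//|P IH]; rewrite uwordS; case: ifP => // SP.
by rewrite rword_rcons IH andbT ideal_root // h.
Qed.

(* The last hypothesis says that the letter at a skipped position commutes with
   the rest of the word, so that using it there would not shorten the word. *)
Lemma lex_min ps qs b :
  sorted ltn ps -> sorted ltn qs -> all (leq b) ps -> all (leq b) qs ->
  rword (map letter ps) -> reduced R A (map letter qs) ->
  weq R A (map letter qs) (map letter ps) ->
  (forall q, (b <= q)%N -> q \notin ps ->
    act A [seq letter p | p <- ps & (q < p)%N] (al (letter q)) = al (letter q)) ->
  lex_le ps qs.
Proof.
elim: ps qs b => [//|p ps IH] [|q qs] b sp sq bp bq rp rq e skip.
  by have := rword_reduced rp e.
have lt_all (x : nat) s : sorted ltn (x :: s) -> all (ltn x) s.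
  by move=> /= /order_path_min; apply; exact: ltn_trans.
have pps := lt_all _ _ sp; have qqs := lt_all _ _ sq.
rewrite /=; case: ltngtP => //= pq.
  have pqs : all (leq q.+1) ps by apply: sub_all pps => x; exact: ltn_trans.
  have qps : q \notin p :: ps.
    rewrite inE negb_or (ltn_eqF pq) /=.
    by apply/negP => /(allP pqs); rewrite ltnn.
  have fE : [seq x <- p :: ps | (q < x)%N] = p :: ps.
    by apply/all_filterP; rewrite /= pq.
  move: bq => /= /andP[bq _].
  have := skip q bq qps; rewrite fE; set v := map letter (p :: ps) in rp e * => fix_q.
  (* If [qs] starts at a skipped q, the letter there commutes with v and prepending it lengthens v;
     but the tail of [qs] spells the same element with fewer letters than v. *)
  have rqv : rword (letter q :: v).
    rewrite -[_ :: v]revK rev_cons; apply: rword_rev.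
    rewrite rword_rcons rword_rev // andbT.
    by rewrite -{1}fix_q act_revK posv_alpha.
  have e1 : weq R A (map letter qs) (letter q :: v).
    by move=> x; rewrite act_cons -e /= reflK.
  have := rword_reduced rqv e1; have := rq v (fun x => esym (e x)).
  rewrite /= !size_map; lia.
subst q; apply: (IH qs p.+1) => //.
- by move: sp => /= /path_sorted.
- by move: sq => /= /path_sorted.
- by move: rp => /=; rewrite -cat1s => /rword_catr.
- move=> v vE.
  suff : (size (letter p :: map letter qs) <= size (letter p :: v))%N by [].
  by apply: rq => x; rewrite /= vE.
- by move=> x; exact: (can_inj (reflK (letter p)) (e x)).
move=> q pq qps; have := skip q; rewrite /= ltnNge (ltnW pq) /=; apply.
  by move: bp => /= /andP[bp _]; exact: leq_trans bp (ltnW pq).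
by rewrite inE negb_or qps andbT gtn_eqF.
Qed.

Lemma uword_cat S q P : (q <= P)%N -> ~~ S q ->
  uword S P = uword S q ++
    [seq letter p | p <- [seq p <- iota 0 P | S p] & (q < p)%N].
Proof.
move=> qP Sq; rewrite /uword -map_cat; congr map.
rewrite -{1 2}(subnKC qP) iotaD !filter_cat add0n.
rewrite [X in _ = _ ++ (X ++ _)](_ : _ = [::]) /=; last first.
  rewrite -filter_predI; apply/eqP; rewrite -[_ == _]negbK -has_filter.
  by apply/hasPn => p; rewrite mem_iota /= add0n => /ltnW; rewrite ltnNge => ->.
congr (_ ++ _); apply/esym/all_filterP/allP => p.
rewrite mem_filter mem_iota => /andP[Sp /andP[qp _]].
by rewrite ltn_neqAle qp andbT; apply: contraNneq Sq => ->.
Qed.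

Lemma ideal_sorting S P : ideal S -> rword (uword S P) ->
  sorting_pos R A cw (uword S P) [seq p <- iota 0 P | S p].
Proof.
move=> iS rS; split.
  split; [exact/sorted_filter/iota_ltn_sorted/ltn_trans| |]; rewrite lettersE //.
  exact: rword_reduced.
move=> qs [sq]; rewrite lettersE => rq e; apply: (@lex_min _ _ 0) => //.
- exact/sorted_filter/iota_ltn_sorted/ltn_trans.
- exact/allP.
- exact/allP.
move=> q _; rewrite mem_filter mem_iota add0n /= negb_and.
have [qP|Pq] := ltnP q P; last first.
  move=> _; rewrite (_ : [seq p <- _ | _] = [::]) //.
  apply/eqP; rewrite -[_ == _]negbK -has_filter; apply/hasPn => p.
  rewrite mem_filter mem_iota add0n => /andP[_ /= pP].
  by rewrite -leqNgt; apply: leq_trans Pq; exact: ltnW.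
rewrite orbF => Sq; have uE := uword_cat (ltnW qP) Sq.
set v := [seq _ | _ <- _] in uE *.
(* A neighbour of the skipped letter cannot occur after q, since the ideal would then contain q; so
   both words agree on the weights involved. *)
apply: (@act_inj (uword S q)); rewrite -act_cat -uE (alpha_sum R A) !linear_sum.
apply: eq_bigr => l _; rewrite !linearZ /=.
have [->|Al] := eqVneq (A l (letter q)) 0; first by rewrite !scale0r.
congr (_ *: _); rewrite !ideal_omega // uE count_cat.
rewrite (_ : count_mem l v = 0)%N ?addn0 //; apply/count_memPn.
apply: contra Sq => /mapP[p]; rewrite !mem_filter mem_iota add0n.
move=> /and3P[qp Sp _] lE; apply: (iS q p) => //.
by rewrite -lE cartan_neq0C.
Qed.

(** The positions p - n and p carry the same letter, so an ideal is closed under p -> p - n, which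
    nests the blocks. *)
Lemma ideal_sortable S P : ideal S -> rword (uword S P) ->
  sortable R A cw (uword S P).
Proof.
move=> iS rS; exists [seq p <- iota 0 P | S p]; split; first exact: ideal_sorting.
move=> j; apply/subsetP => i; rewrite !inE !lettersE => /mapP[p].
rewrite !mem_filter mem_iota size_coxeter add0n => /and3P[/eqP pj Sp /= pP] iE.
have pE : p = (1 * n + (p - n))%N.
  by rewrite mul1n subnKC // -divn_gt0 ?rank_gt0 // pj.
have lE : letter (p - n) = letter p by rewrite {2}pE letterD.
apply/mapP; exists (p - n)%N; last by rewrite lE.
have lt : (p - n < p)%N by rewrite {2}pE mul1n -addn1 addnC leq_add2r rank_gt0.
rewrite !mem_filter mem_iota add0n /= (ltn_trans lt pP) (iS _ _ lt Sp) ?andbT.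
  by rewrite -eqSS -add1n -pj {2}pE divnMDl ?rank_gt0.
by rewrite lE; case: HA => -> _ _.
Qed.

(** * Order ideals described by heights *)

Definition below (k : 'I_n -> nat) : pred nat :=
  fun p => (p %/ n < k (letter p))%N.

(** Occurrences of neighbours alternate in c^oo as i j i j ..., hence the two bounds. *)
Definition ideal_height (k : 'I_n -> nat) :=
  forall i j, before i j -> A i j != 0 ->
  (k j <= k i <= (k j).+1)%N.

Lemma ideal_below k : ideal_height k -> ideal (below k).
Proof.
move=> ok q p qp; rewrite /below => kp Aqp.
have qp_div : (q %/ n <= p %/ n)%N by rewrite leq_div2r // ltnW.
have [<-|ne] := eqVneq (letter p) (letter q); first exact: leq_ltn_trans kp.
have := beforeP ne; case: (boolP (before (letter p) (letter q))) => b b'.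
  have /andP[_ h] := ok _ _ b (etrans (cartan_neq0C _ _) Aqp).
  suff : (q %/ n < p %/ n)%N by move: h kp; lia.
  rewrite ltn_neqAle qp_div andbT; apply: contraTneq b => e.
  rewrite /before !index_letter -leqNgt.
  by move: qp; rewrite {1}(divn_eq q n) {1}(divn_eq p n) e ltn_add2l => /ltnW.
have {b'} b' : before (letter q) (letter p) by rewrite -[before _ _]negbK -b'.
have /andP[h _] := ok _ _ b' Aqp.
by apply: leq_trans h; exact: leq_ltn_trans kp.
Qed.

Lemma count_below k P l : (forall i, k i * n <= P)%N ->
  count_mem l (uword (below k) P) = k l.
Proof.
move=> kP; rewrite -[RHS](count_cword l) -[cword _ _]cats0.
rewrite -[_ ++ [::]]/(cword cw (k l) ++ uword predT 0) -uword_predTD addn0.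
rewrite /uword !count_map !count_filter -(subnKC (kP l)) iotaD count_cat add0n.
rewrite [X in (_ + X)%N](_ : _ = 0)%N ?addn0; last first.
  apply/eqP; rewrite -leqn0 leqNgt -has_count; apply/hasPn => p.
  rewrite mem_iota /below => /andP[kp _] /=; apply/andP => -[/eqP -> pk].
  by move: pk; rewrite ltnNge leq_divRL ?rank_gt0 // kp.
apply: eq_in_count => p; rewrite mem_iota add0n /below /= => pk.
by case: eqP => //= ->; rewrite ltn_divLR ?rank_gt0.
Qed.

Lemma below_omega k P l : ideal_height k -> (forall i, k i * n <= P)%N ->
  act A (uword (below k) P) (omega R l) = cpow A cw (k l) (omega R l).
Proof. by move=> ok kP; rewrite ideal_omega ?count_below //; exact: ideal_below. Qed.

Lemma below_rword k P : ideal_height k ->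
  (forall i m, (m < k i)%N -> posv (beta i m)) -> rword (uword (below k) P).
Proof.
move=> ok h; apply: ideal_rword; first exact: ideal_below.
by move=> p; exact: h.
Qed.

(* The number of leading positive roots among beta_{i,0}, ..., beta_{i,N-1};
   the cap disappears once [height_lt] bounds it by the length of w0. *)
Definition capped_height N i := find (fun m => ~~ posv (beta i m)) (iota 0 N).

Lemma capped_height_le N i : (capped_height N i <= N)%N.
Proof. by rewrite -{2}(size_iota 0 N) find_size. Qed.

Lemma capped_height_posv N i m : (m < capped_height N i)%N -> posv (beta i m).
Proof.
move=> mh; have := before_find 0%N mh.
rewrite nth_iota ?(leq_trans mh (capped_height_le _ _)) // add0n.
by move/negbFE.
Qed.

Lemma capped_height_neg N i : (capped_height N i < N)%N ->
  exists j, cpow A cw (capped_height N i) (omega R i) = - omega R j.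
Proof.
move=> hN; apply: first_neg_beta; first exact: capped_height_posv.
have := hN; rewrite -{2}(size_iota 0 N) -has_find => /(nth_find 0%N).
by rewrite nth_iota.
Qed.

Lemma root_coord_cpow i j m k :
  zeta i (beta j k) = B (cpow A cw m (omega R i)) (beta j (m + k)).
Proof. by rewrite betaD ip_cpow. Qed.

Lemma ip_Nomega_le0 i j m : posv (beta j m) -> B (- omega R i) (beta j m) <= 0.
Proof. by move=> /posvP h; rewrite ipNl oppr_le0; exact: h. Qed.

(* By c-invariance, B(c^m omega_i, beta_{j,m+k}) = B(omega_i, beta_{j,k}); once
   c^m omega_i = - omega_l the left side is <= 0, whereas the right side is > 0
   for the appropriate k when i and j are neighbours. *)
Lemma ideal_capped_height N : ideal_height (capped_height N).
Proof.
move=> i j bij Aij; apply/andP; split; rewrite leqNgt; apply/negP => h.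
  have [l lE] := capped_height_neg (leq_trans h (capped_height_le N j)).
  have := root_coord_beta0_gt0 bij Aij.
  rewrite (root_coord_cpow _ _ (capped_height N i)) lE addn0 ltNge.
  by rewrite ip_Nomega_le0 // (capped_height_posv h).
have hj : (capped_height N j < N)%N.
  by apply: leq_trans (capped_height_le N i); exact: ltnW.
have [l lE] := capped_height_neg hj.
have := root_coord_beta1_gt0 bij Aij.
rewrite (root_coord_cpow _ _ (capped_height N j)) lE addn1 ltNge.
by rewrite ip_Nomega_le0 // (capped_height_posv h).
Qed.

(** * Heights and the longest element *)

Variable w0 : seq 'I_n.
Hypothesis Hw0 : longest R A w0.

Definition height := capped_height (size w0).+1.
Local Notation star := (istar R A w0).

(** The capped heights cut out a reduced word, no longer than w0, in which i occurs [height i]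
    times. *)
Lemma height_lt i : (height i < (size w0).+1)%N.
Proof.
pose N := (size w0).+1.
have r : rword (uword (below height) (N * n)).
  by apply: below_rword; [exact: ideal_capped_height|exact: capped_height_posv].
rewrite ltnS; case: Hw0 => _ /(_ _ (rword_reduced r)); apply: leq_trans.
rewrite -(@count_below height (N * n)) ?count_size // => j.
by rewrite leq_mul2r capped_height_le orbT.
Qed.

Lemma height_omega i : exists j,
  cpow A cw (height i) (omega R i) = - omega R j.
Proof. exact: capped_height_neg (height_lt i). Qed.

Lemma posv_beta i m : (m < height i)%N -> posv (beta i m).
Proof. exact: capped_height_posv. Qed.

Lemma ideal_height_height : ideal_height height.
Proof. exact: ideal_capped_height. Qed.

(* The word cut out of c^oo by the heights maps every omega_j to an antidominant
   weight, so it represents w0. *)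
Lemma longest_omega i : act A w0 (omega R i) = cpow A cw (height i) (omega R i).
Proof.
have hP j : (height j * n <= (size w0).+1 * n)%N.
  by rewrite leq_mul2r capped_height_le orbT.
rewrite -(below_omega i ideal_height_height hP).
apply/esym/longest_unique => // j; set L := uword _ _.
have rL : isroot (act A L (al j)) by apply/isroot_act/isroot_alpha.
rewrite root_negE //; apply/negP => /posvP pL.
have [l lE] := height_omega j.
have := halfnorm_gt0 j; rewrite -(root_coord_alpha_id j) /root_coord -(ip_act L).
by rewrite /L (below_omega j ideal_height_height hP) lE ipNl oppr_gt0 ltNge pL.
Qed.

Lemma longest_star i : act A w0 (omega R i) = - omega R (star i).
Proof.
rewrite /istar; case: pickP => [j /eqP -> /=|h]; first by rewrite opprK.
(* A witness exists, so the default value in [istar] is never taken. *)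
have [l lE] := height_omega i.
by have := h l; rewrite longest_omega lE opprK eqxx.
Qed.

Lemma cpow_height i : cpow A cw (height i) (omega R i) = - omega R (star i).
Proof. by rewrite -longest_omega longest_star. Qed.

Lemma starK i : star (star i) = i.
Proof.
apply: (@omega_inj R n); rewrite -[RHS](longestK _ Hw0) !longest_star linearN /=.
by rewrite longest_star opprK.
Qed.

Lemma beta_star i m : cpow A cw m (omega R i) = - omega R (star i) ->
  beta i m = - beta (star i) 0.
Proof. by rewrite /beta /= => ->; rewrite linearN /= opprB opprK addrC. Qed.

Lemma beta_height i : beta i (height i) = - beta (star i) 0.
Proof. exact: beta_star (cpow_height i). Qed.

Lemma is_h_height i : is_h R A w0 cw i (height i).
Proof.
have neq m : (m < height i)%N -> cpow A cw m (omega R i) <> - omega R (star i).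
  move=> mh /beta_star e; have := posv_beta mh; rewrite e => /negP[].
  by rewrite root_negE ?posv_beta0 //; exact: isroot_beta.
split; [|exact: cpow_height|by move=> m /andP[_ /neq]].
rewrite lt0n; apply/eqP => h0; have := beta_height i; rewrite h0 => e.
have := posv_beta0 i; rewrite e => /negP[].
by rewrite root_negE ?posv_beta0 //; exact: isroot_beta.
Qed.

Lemma is_hE i h : is_h R A w0 cw i h -> h = height i.
Proof.
have [h0 e mn] := is_h_height i; case=> h0' e' mn'.
case: (ltngtP h (height i)) => // lt.
  by case: (mn h _ e'); rewrite h0'.
by case: (mn' _ _ e); rewrite h0.
Qed.

Lemma star_cartan i j : A i j != 0 -> A (star i) (star j) != 0.
Proof.
have w0al k : act A w0 (al k) = (- d k / d (star k)) *: al (star k).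
  have z l : zeta l (act A w0 (al k)) = - (star l == k)%:R * d k.
    rewrite /root_coord -{1}(revK w0) -ip_act_rev (longest_rev Hw0) longest_star.
    by rewrite ipNl -/(zeta _ _) root_coord_alpha mulNr.
  rewrite (root_coord_expand (act A w0 (al k))) (bigD1 (star k)) //= big1 => [|l lk].
    by rewrite z starK eqxx mulN1r addr0.
  rewrite z (_ : (star l == k) = false) ?oppr0 ?mul0r ?scale0r //.
  by apply: contraNF lk => /eqP <-; rewrite starK.
rewrite -!ip_alpha_neq0 -(ip_act w0) !w0al ipZl BZr.
by apply: contra => /eqP ->; rewrite !mulr0.
Qed.

Lemma before_star_of_eq i j : before i j -> A i j != 0 ->
  height i = height j -> before (star i) (star j).
Proof.
move=> bij Aij e; have := root_coord_beta0_gt0 bij Aij.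
rewrite (root_coord_cpow _ _ (height i)) cpow_height addn0 e beta_height.
rewrite ipNl BNr opprK -/(zeta _ _) => zp.
rewrite beforeP; first by apply: contraTN zp => /before_beta0 ->; rewrite ltxx.
apply: contraTneq bij => h; have -> : i = j by rewrite -(starK i) h starK.
by rewrite /before ltnn.
Qed.

(** The same argument, with c^(height j) applied to omega_j and beta_(i,1). *)
Lemma before_star_of_succ i j : before i j -> A i j != 0 ->
  height i = (height j).+1 -> before (star j) (star i).
Proof.
move=> bij Aij e; have := root_coord_beta1_gt0 bij Aij.
rewrite (root_coord_cpow _ _ (height j)) cpow_height addn1 -e beta_height.
rewrite ipNl BNr opprK -/(zeta _ _) => zp.
rewrite beforeP; first by apply: contraTN zp => /before_beta0 ->; rewrite ltxx.
apply: contraTneq bij => h; have -> : j = i by rewrite -(starK j) h starK.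
by rewrite /before ltnn.
Qed.

End Positions.

End CoxeterElement.

Lemma before_rev cw i j : coxeter_word cw -> before (rev cw) i j -> before cw j i.
Proof.
move=> Hc; move/(before_split (coxeter_word_rev Hc)) => [u [v [w e]]].
have cE : cw = rev w ++ j :: rev v ++ i :: rev u.
  by rewrite -[LHS]revK e !(rev_cat, rev_cons) -!cats1 -!catA.
have [iw jw jv iv /andP[_ ji]] := before_notin Hc cE.
rewrite /before cE !index_cat (negPf iw) (negPf jw) /= eqxx (negPf ji).
by rewrite addn0 -[X in (X < _)%N]addn0 ltn_add2l.
Qed.

Lemma cpow_revK cw m x : cpow A (rev cw) m (cpow A cw m x) = x.
Proof.
elim: m x => [//|m IH] x.
by rewrite /cpow [LHS]iterSr iterS act_revK; exact: IH.
Qed.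

Lemma sortable_weq cw u v : weq R A u v -> sortable R A cw u -> sortable R A cw v.
Proof.
move=> uv [ps [[[s r e] h] b]]; exists ps; split=> //; split.
  by split=> // x; rewrite e uv.
by move=> qs [sq rq eq]; apply: h; split=> // x; rewrite eq uv.
Qed.

(** * Existence of singletons *)

Section SingletonExistence.
Variables (w0 cw : seq 'I_n).
Hypotheses (Hw0 : longest R A w0) (Hcw : coxeter_word cw).
Local Notation star := (istar R A w0).
Local Notation ht := (height cw w0).

Lemma cpow_rev_omega i m : (m <= ht (star i))%N ->
  cpow A (rev cw) m (omega R i) = - cpow A cw (ht (star i) - m) (omega R (star i)).
Proof.
move=> mh; rewrite -[in LHS](starK Hcw i Hw0 i) -[omega R (star _)]opprK.
rewrite -(cpow_height Hcw i Hw0) -{1}(subnKC mh) cpowD cpowN.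
by rewrite cpow_revK.
Qed.

Lemma beta_rev i m : (m < ht (star i))%N ->
  beta (rev cw) i m = beta cw (star i) (ht (star i) - m.+1).
Proof.
move=> mh; rewrite /beta !cpow_rev_omega // ?(ltnW mh) // -subSn // subSS.
by rewrite opprK addrC.
Qed.

Lemma ideal_height_min m : ideal_height cw (fun j => minn m (ht j)).
Proof.
move=> i j bij Aij.
have := ideal_height_height Hcw w0 bij Aij; rewrite /= -/ht; lia.
Qed.

(** The order of i and j in c rules out one of the two possible height differences of i* and j*; the
    remaining one fits the reversed word. *)
Lemma ideal_height_rev m :
  ideal_height (rev cw) (fun j => (ht (star j) - m)%N).
Proof.
move=> i j /(before_rev Hcw) bji Aij.
have Aji : A j i != 0 by rewrite cartan_neq0C.
have sAij := star_cartan Hcw i Hw0 Aij; have sAji := star_cartan Hcw i Hw0 Aji.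
have nb a b : before cw a b -> before cw b a -> False.
  by rewrite /before => ab /(ltn_trans ab); rewrite ltnn.
have ne : star i != star j.
  apply: contraTneq bji => h; have -> : i = j.
    by rewrite -(starK Hcw i Hw0 i) h (starK Hcw i Hw0).
  by rewrite /before ltnn.
case: (boolP (before cw (star i) (star j))) => b.
  have o := ideal_height_height Hcw w0 b sAij.
  have s1 := before_star_of_eq Hcw i Hw0 b sAij.
  rewrite !(starK Hcw i Hw0 _) in s1.
  have /eqP h : ht (star i) != ht (star j).
    by apply/eqP => /s1; exact: nb.
  move: o h; rewrite -/ht; lia.
have {}b : before cw (star j) (star i).
  by rewrite (beforeP Hcw) // eq_sym.
have o := ideal_height_height Hcw w0 b sAji.
have s1 := before_star_of_succ Hcw i Hw0 b sAji.
rewrite !(starK Hcw i Hw0 _) in s1.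
have /eqP h : ht (star j) != (ht (star i)).+1.
  by apply/eqP => /s1; exact: nb.
move: o h; rewrite -/ht; lia.
Qed.

(* With j' the dual of j, u w0 omega_j = c^(k_{j'} - h_{j'}) omega_j, so u w0 is
   cut out of the infinite power of c^-1 by the complementary heights. *)
Lemma exists_singleton i m : (m <= ht i)%N -> exists2 u, singleton R A w0 cw u &
  act A u (omega R i) = cpow A cw m (omega R i).
Proof.
move=> mh; pose k j := minn m (ht j); pose k' j := (ht (star j) - m)%N.
pose P := ((size w0).+1 * n)%N.
have htP j : (ht j * n <= P)%N by rewrite leq_mul2r capped_height_le orbT.
have kP j : (k j * n <= P)%N.
  by apply: leq_trans (htP j); rewrite leq_mul2r geq_minr orbT.
have kP' j : (k' j * n <= P)%N.
  by apply: leq_trans (htP (star j)); rewrite leq_mul2r leq_subr orbT.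
have Hr := coxeter_word_rev Hcw.
pose u := uword cw i (below cw i k) P.
pose u' := uword (rev cw) i (below (rev cw) i k') P.
have ok : ideal_height cw k := ideal_height_min m.
have ok' : ideal_height (rev cw) k' := ideal_height_rev m.
have ru : rword u.
  apply: below_rword => // j l lk; apply: (@posv_beta _ w0).
  by apply: leq_trans lk _; rewrite geq_minr.
have ru' : rword u'.
  apply: below_rword => // j l lk; rewrite /k' in lk.
  have lh : (l < ht (star j))%N by apply: leq_trans lk _; rewrite leq_subr.
  by rewrite beta_rev //; apply: (@posv_beta _ w0); rewrite -/ht; lia.
exists u; last by rewrite below_omega // /k (minn_idPl mh).
split; first exact/ideal_sortable/ru/ideal_below.
apply: (@sortable_weq _ u'); last exact/ideal_sortable/ru'/ideal_below.
apply: act_omega_eq => j; rewrite act_cat (longest_star Hcw i Hw0) linearN /=.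
rewrite !below_omega // cpow_rev_omega ?leq_subr //.
by congr (- cpow _ _ _ _); rewrite /k /k'; lia.
Qed.

End SingletonExistence.

(** * The Euler form and singletons *)

Section EulerForm.
Implicit Types (cw c : seq 'I_n) (s : 'I_n).

Definition one_minus cw : 'M[R]_n := 1%:M - lin1_mx (@act R n A cw).

Definition resolvent cw x := x *m invmx (one_minus cw).

Definition euler cw x y := B (resolvent cw x) y.

Lemma mul_one_minus cw x : x *m one_minus cw = x - act A cw x.
Proof. by rewrite mulmxBr mulmx1 mul_rV_lin1. Qed.

Lemma one_minus_unit cw : coxeter_word cw -> one_minus cw \in unitmx.
Proof.
move=> Hc; rewrite -row_free_unit -kermx_eq0; apply/rowV0P => v /sub_kermxP.
rewrite mul_one_minus => /eqP; rewrite subr_eq0 eq_sym => /eqP.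
exact: coxeter_fixed.
Qed.

Lemma resolventP cw x : coxeter_word cw ->
  resolvent cw x - act A cw (resolvent cw x) = x.
Proof. by move=> Hc; rewrite -mul_one_minus mulmxKV // one_minus_unit. Qed.

Lemma resolvent_eq cw x y : coxeter_word cw -> y - act A cw y = x ->
  resolvent cw x = y.
Proof.
by move=> Hc <-; rewrite -mul_one_minus /resolvent mulmxK // one_minus_unit.
Qed.

Lemma eulerBl cw x y z : euler cw (x - y) z = euler cw x z - euler cw y z.
Proof. by rewrite /euler /resolvent mulmxBl ipBl. Qed.

Lemma eulerZl cw k x z : euler cw (k *: x) z = k * euler cw x z.
Proof. by rewrite /euler /resolvent -scalemxAl ipZl. Qed.

Lemma eulerBr cw x y z : euler cw x (y - z) = euler cw x y - euler cw x z.
Proof. exact: BBr. Qed.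

Lemma eulerDr cw x y z : euler cw x (y + z) = euler cw x y + euler cw x z.
Proof. exact: BDr. Qed.

Lemma eulerZr cw k x y : euler cw x (k *: y) = k * euler cw x y.
Proof. exact: BZr. Qed.

Lemma eulerNr cw x y : euler cw x (- y) = - euler cw x y.
Proof. exact: BNr. Qed.

(** With x = (1 - c) u and y = (1 - c) v, expand B x y and use B(cu, cv) = B(u, v). *)
Lemma euler_sym cw x y : coxeter_word cw -> euler cw x y + euler cw y x = B x y.
Proof.
move=> Hc; rewrite /euler; have := resolventP x Hc; have := resolventP y Hc.
move: (resolvent cw x) (resolvent cw y) => u v <- <-.
by rewrite !ipBl !BBr ip_act (BC v u) (BC v (act A cw u)); ring.
Qed.

(** The adjoint of 1 - c is 1 - c^-1. *)
Lemma euler_rev cw x y : coxeter_word cw -> euler (rev cw) x y = euler cw y x.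
Proof.
move=> Hc; rewrite /euler; have := resolventP x (coxeter_word_rev Hc).
have := resolventP y Hc.
move: (resolvent (rev cw) x) (resolvent cw y) => u v <- <-.
by rewrite !BBr (BC u v) (BC u (act A cw v)) ip_act_rev.
Qed.

Lemma coxeter_word_rcons c s : coxeter_word (s :: c) -> coxeter_word (rcons c s).
Proof. by rewrite /coxeter_word perm_rcons. Qed.

(** For an initial letter s, (1 - c) omega_s = alpha_s. *)
Lemma euler_initial c s y : coxeter_word (s :: c) ->
  euler (s :: c) (al s) y = zeta s y.
Proof.
move=> Hc; rewrite /euler (@resolvent_eq _ _ (omega R s)) //.
exact: (@coxeter_omega _ Hc [::]).
Qed.

Lemma euler_final c s y : coxeter_word (s :: c) ->
  euler (rcons c s) y (al s) = zeta s y.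
Proof.
move=> Hc; have Hr := coxeter_word_rev (coxeter_word_rcons Hc).
rewrite -(revK (rcons c s)) euler_rev // rev_rcons euler_initial //.
by rewrite -rev_rcons.
Qed.

Lemma euler_rot c s x y : coxeter_word (s :: c) ->
  euler (rcons c s) (refl A s x) (refl A s y) = euler (s :: c) x y.
Proof.
move=> Hc; rewrite /euler (@resolvent_eq _ _ (refl A s (resolvent (s :: c) x))).
- by rewrite ip_refl.
- exact: coxeter_word_rcons.
by rewrite act_rcons reflK -[in RHS](resolventP x Hc) linearB /= reflK.
Qed.

(** Rotate by s; the corrections along alpha_s cancel because x and y have no alpha_s-coordinate. *)
Lemma euler_restrict c s x y : coxeter_word (s :: c) ->
  zeta s x = 0 -> zeta s y = 0 -> euler (rcons c s) x y = euler (s :: c) x y.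
Proof.
move=> Hc zx zy; rewrite -[x in LHS](reflK s) -[y in LHS](reflK s) euler_rot //.
have e : euler (s :: c) x (al s) = x 0 s * d s.
  have := euler_sym x (al s) Hc; rewrite euler_initial // zx addr0 => ->.
  exact: ip_alphar.
rewrite /refl !(eulerBl, eulerZl, eulerBr, eulerZr) e !euler_initial //.
by rewrite zy root_coord_alpha_id; ring.
Qed.

End EulerForm.

(** * Signs of the Euler form along nested words *)

Section NestedWords.
Variables (cw : seq 'I_n) (i0 : 'I_n).
Hypothesis Hcw : coxeter_word cw.
Local Notation lt := (letter cw i0).
Local Notation uw := (uword cw i0).

Definition nested (S : pred nat) := forall q p, (q < p)%N -> S p ->
  lt q = lt p -> S q.

(** The rotation of the Coxeter word that starts at position p of c^oo. *)
Definition window p := map lt (iota p n).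

Lemma window_cons p : exists c,
  window p = lt p :: c /\ window p.+1 = rcons c (lt p).
Proof.
exists (map lt (iota p.+1 n.-1)); rewrite /window.
have n0 := rank_gt0 i0.
have -> : iota p n = p :: iota p.+1 n.-1 by rewrite -{1}(prednK n0).
have -> : iota p.+1 n = rcons (iota p.+1 n.-1) (1 * n + p)%N.
  by rewrite -{1}(prednK n0) -(addn1 n.-1) iotaD cats1 mul1n addSnnS prednK // addnC.
by rewrite map_rcons letterD.
Qed.

Lemma window0 : window 0 = cw.
Proof.
have := uword_predT_small Hcw i0 (leqnn n).
by rewrite /uword filter_predT take_oversize ?size_coxeter.
Qed.

Lemma coxeter_window p : coxeter_word (window p).
Proof.
elim: p => [|p]; first by rewrite window0.
by case: (window_cons p) => c [-> ->]; exact: coxeter_word_rcons.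
Qed.

Variable S : pred nat.
Hypothesis nS : nested S.

(** x involves only simple roots whose letters have not been skipped before q. *)
Definition supported q x := forall l, zeta l x != 0 ->
  forall r, (r < q)%N -> lt r = l -> S r.

(* Once a letter is skipped it never occurs again, so skipping it only changes
   the Euler form outside the span of the remaining simple roots. *)
Lemma euler_transport q x y : supported q x -> supported q y ->
  euler cw (act A (uw S q) x) (act A (uw S q) y) = euler (window q) x y.
Proof.
elim: q x y => [|q IH] x y sx sy; first by rewrite window0.
have [c [e e']] := window_cons q; have Hw := coxeter_window q.
rewrite uwordS e'; case: ifP => Sq.
  have s_refl z : supported q.+1 z -> supported q (refl A (lt q) z).
    move=> sz l zl r rq rl; have [lq|lq] := eqVneq l (lt q).
      by apply: (nS rq Sq); rewrite rl.
    by apply: (sz l) => //; [rewrite -(root_coord_refl_neq z lq)|exact: ltnW].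
  rewrite !act_rcons IH; try exact: s_refl.
  by rewrite e -euler_rot ?reflK // -e.
have z0 z : supported q.+1 z -> zeta (lt q) z = 0.
  move=> sz; apply/eqP; apply: contraFT Sq => zq.
  exact: (sz _ zq).
have s_le z : supported q.+1 z -> supported q z.
  by move=> sz l zl r rq; apply: (sz l zl); exact: ltnW.
rewrite IH; try exact: s_le.
by rewrite e euler_restrict ?z0 // -e.
Qed.

Definition segment q p := [seq lt r | r <- iota q (p - q) & S r].

Lemma uword_segment q p : (q <= p)%N -> uw S p = uw S q ++ segment q p.
Proof. by move=> qp; rewrite /uword -{1}(subnKC qp) iotaD filter_cat map_cat. Qed.

Lemma mem_segment q p l :
  l \in segment q p -> exists r, [/\ (q <= r < p)%N, S r & lt r = l].
Proof.
case/mapP => r; rewrite mem_filter mem_iota => /andP[Sr /andP[qr rp]] ->.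
exists r; split=> //; rewrite qr /=; move: rp; lia.
Qed.

Lemma supported_segment q p : (q <= p)%N -> S p ->
  supported q (act A (segment q p) (al (lt p))).
Proof.
move=> qp Sp l zl r rq rl.
have [e|e] := eqVneq l (lt p).
  by apply: (nS _ Sp); rewrite ?rl // (leq_trans rq).
have : l \in segment q p.
  apply: contraNT zl => ls; rewrite root_coord_act_notin // root_coord_alpha (negPf e).
  by rewrite mul0r.
move=> /mem_segment[t [/andP[qt _] St tl]].
by apply: (nS _ St); rewrite ?rl // (leq_trans rq).
Qed.

Lemma rword_uword_le p P : (p <= P)%N -> rword (uw S P) -> rword (uw S p).
Proof. by move=> /uword_segment ->; exact: rword_catl. Qed.

Lemma segment_posv q p : (q <= p)%N -> S p -> rword (uw S p.+1) ->
  posv (act A (segment q p) (al (lt p))).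
Proof.
move=> qp Sp; rewrite uwordS Sp (uword_segment qp) rcons_cat => /rword_catr.
by rewrite rword_rcons => /andP[].
Qed.

Local Notation wroot p := (act A (uw S p) (al (lt p))).

(** Transport back to q+1: the earlier root becomes -alpha for the final letter of the window, the
    later one stays positive, and [euler_final] reads off a coordinate. *)
Lemma euler_later_le0 q p : (q < p)%N -> S q -> S p -> rword (uw S p.+1) ->
  euler cw (wroot p) (wroot q) <= 0.
Proof.
move=> qp Sq Sp rp; rewrite (uword_segment qp) act_cat.
rewrite -[al (lt q)]opprK -refl_alpha linearN /= -act_rcons.
have -> : rcons (uw S q) (lt q) = uw S q.+1 by rewrite uwordS Sq.
rewrite eulerNr euler_transport; first 1 last.
- exact: supported_segment.
- move=> l; have [->|lq] := eqVneq l (lt q); last first.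
    by rewrite root_coord_alpha (negPf lq) mul0r eqxx.
  move=> _ r; rewrite ltnS leq_eqVlt => /orP[/eqP -> //|rq].
  exact: (nS rq Sq).
have [c [e e']] := window_cons q.
rewrite e' euler_final; last by rewrite -e; exact: coxeter_window.
by rewrite oppr_le0; move/posvP: (segment_posv qp Sp rp) => ->.
Qed.

Lemma mem_roots_uword P x : x \in roots (uw S P) ->
  exists2 p, (p < P)%N && S p & x = wroot p.
Proof.
elim: P => [//|P IH]; rewrite uwordS; case: ifP => SP.
  rewrite roots_rcons mem_rcons inE => /orP[/eqP ->|].
    by exists P; rewrite ?SP ?ltnSn.
  by case/IH => p /andP[pP Sp] ->; exists p; rewrite // Sp ltnW.
by case/IH => p /andP[pP Sp] ->; exists p; rewrite // Sp ltnW.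
Qed.

Lemma wroot_mem p P : (p < P)%N -> S p -> wroot p \in roots (uw S P).
Proof.
elim: P => [//|P IH]; rewrite ltnS leq_eqVlt => /orP[/eqP <-|pP] Sp; rewrite uwordS.
  by rewrite Sp roots_rcons mem_rcons mem_head.
by case: ifP => _; rewrite ?roots_rcons ?mem_rcons ?inE IH ?orbT.
Qed.

Lemma isroot_wroot p : isroot (wroot p).
Proof. exact/isroot_act/isroot_alpha. Qed.

End NestedWords.

(** * The letters of a singleton form an ideal *)

Section SingletonIdeal.
Variables (w0 cw : seq 'I_n) (i0 : 'I_n).
Hypotheses (Hw0 : longest R A w0) (Hcw : coxeter_word cw).
Variables (S S' : pred nat) (P P' : nat).
Hypotheses (nS : nested cw i0 S) (nS' : nested (rev cw) i0 S').
Hypothesis (SP : forall p, S p -> (p < P)%N).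
Local Notation uw := (uword cw i0 S).
Local Notation uw' := (uword (rev cw) i0 S').
Hypotheses (rw : rword (uw P)) (rw' : rword (uw' P')).
Hypothesis ww' : weq R A (uw' P') (uw P ++ w0).
Local Notation lt := (letter cw i0).
Local Notation lt' := (letter (rev cw) i0).
Local Notation wroot p := (act A (uw p) (al (lt p))).
Local Notation wroot' p := (act A (uw' p) (al (lt' p))).

(** (u w0)^-1 = w0 u^-1, and w0 exchanges positive and negative roots. *)
Lemma posv_complement x : isroot x -> posv (act A (rev (uw' P')) x) =
  ~~ posv (act A (rev (uw P)) x).
Proof.
move=> rx; rewrite (weq_rev ww') rev_cat act_cat (longest_rev Hw0).
have ry := isroot_act (rev (uw P)) rx; move: (act A _ x) ry => y ry.
case: (boolP (posv y)) => py.
  have := act_longest_negv Hw0 py; rewrite root_negE; last exact: isroot_act.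
  by move/negbTE.
move: py; rewrite -root_negE // => /(act_longest_negv Hw0).
by rewrite linearN /= opprK => ->.
Qed.

(* x and x + k y are both inversions of the complement of w, and y is not, so x
   comes first in its sorting word; [euler_later_le0] for the reversed Coxeter
   word then gives the form the wrong sign on this pair. *)
Lemma complement_pair_false x y k : isroot x -> posv x -> isroot y -> posv y ->
  isroot (x + k *: y) -> posv (x + k *: y) -> 0 < k ->
  posv (act A (rev (uw P)) (x + k *: y)) ->
  ~~ posv (act A (rev (uw P)) y) -> 0 <= euler cw x y -> False.
Proof.
move=> rx px ry py rz pz k0 wz wy exy.
have Hr := coxeter_word_rev Hcw.
have : x + k *: y \in roots (uw' P').
  by rewrite mem_rootsE // posv_complement // wz.
case/mem_roots_uword => b /andP[bP Sb] zb.
have rb : rword (uw' b.+1) by apply: rword_uword_le rw'.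
case: (boolP (x \in roots (uw' b.+1))) => xb.
  case/mem_roots_uword: xb => a /andP[]; rewrite ltnS leq_eqVlt.
  case/orP => [/eqP -> _ xE|ab Sa xE].
    move: zb; rewrite -xE => /eqP; rewrite -subr_eq0 addrC addKr scaler_eq0.
    by rewrite gt_eqF //= (negPf (isroot_neq0 ry)).
  (* This reads E(x, x) + k E(x, y) <= 0, whereas E(x, x) = B x x / 2 > 0. *)
  have := euler_later_le0 Hr nS' ab Sa Sb rb; rewrite -zb -xE euler_rev //.
  rewrite eulerDr eulerZr; have := euler_sym x x Hcw.
  have := ip_gt0 (isroot_neq0 rx); have := mulr_ge0 (ltW k0) exy.
  lra.
(* Otherwise neither x nor y is an inversion of the prefix ending at b, hence neither is x + k y. *)
have := wroot_mem (rev cw) i0 (ltnSn b) Sb; rewrite -zb mem_rootsE // => /negP[].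
rewrite linearD linearZ /=; apply: posvD.
  by move: xb; rewrite mem_rootsE // negbK.
apply: posvZ; first exact: ltW.
apply: contraT => /(mem_roots_neg ry py)/mem_roots_uword[a /andP[ab Sa] ya].
have := wroot_mem (rev cw) i0 (leq_trans ab bP) Sa; rewrite -ya mem_rootsE //.
by rewrite posv_complement // wy.
Qed.

(* If a letter l is skipped while a neighbour j comes later, take the first such
   j and consider the root x = u alpha_l at the skipped position. If x < 0, then
   - x is an earlier root of the sorting word and pairs with the root of j with
   the wrong sign; if x > 0, then [complement_pair_false] applies. *)
Lemma nested_ideal : ideal cw i0 S.
Proof.
move=> q p qp Sp Aqp; apply: contraT => Sq; set l := lt q in Aqp.
have exq : exists r, (lt r == l) && ~~ S r by exists q; rewrite Sq eqxx.
(* The first skipped occurrence of l is taken so that alpha_l is still supported at q0. *)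
case: (ex_minnP exq) => q0 /andP[/eqP lq0 Sq0] minq0.
have q0p : (q0 < p)%N.
  by apply: leq_ltn_trans qp; apply: minq0; rewrite eqxx Sq.
have exp : exists r, [&& (q0 < r)%N, S r & A l (lt r) != 0].
  by exists p; rewrite q0p Sp Aqp.
case: (ex_minnP exp) => p0 /and3P[q0p0 Sp0 Ap0] minp0.
set j := lt p0 in Ap0.
have no_l r : (q0 <= r)%N -> S r -> lt r != l.
  rewrite leq_eqVlt => /orP[/eqP <-|q0r] Sr; first by rewrite Sr in Sq0.
  by apply: contraNneq Sq0 => e; apply: (nS q0r Sr); rewrite e.
have jl : j != l by apply: no_l => //; exact: ltnW.
set v := segment cw i0 S q0 p0.
have nbr i : i \in v -> A l i = 0.
  case/mem_segment => r [/andP[q0r rp0] Sr <-]; apply/eqP; apply: contraT => Al.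
  have q0r' : (q0 < r)%N.
    by rewrite ltn_neqAle q0r andbT; apply: contraNneq Sq0 => ->.
  by have := minp0 r; rewrite q0r' Sr Al leqNgt rp0 => /(_ isT).
have lv : l \notin v.
  apply/negP => /nbr; case: HA => -> _ _; move/eqP; by rewrite pnatr_eq0.
have jv : j \notin v by apply: contraNN Ap0 => /nbr/eqP.
have fix_v : act A v (al l) = al l.
  elim: v nbr {lv jv} => [//|i v IH] nbr; rewrite act_cons IH => [|k kv]; last first.
    by apply: nbr; rewrite inE kv orbT.
  rewrite /refl mxE (_ : A i l = 0) ?scale0r ?subr0 //; apply/eqP.
  apply: contraT => Ail; have /eqP := nbr i (mem_head _ _).
  by rewrite -[_ == 0]negbK -cartan_neq0C Ail.
set U := uw q0.
have uE : uw p0 = U ++ v by apply: uword_segment; exact: ltnW.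
have p0P := SP Sp0.
have q0P : (q0 <= P)%N by apply: ltnW; exact: ltn_trans p0P.
have rp0 : rword (uw p0.+1) by apply: rword_uword_le rw.
set y := act A v (al j).
have py : posv y by apply: segment_posv => //; exact: ltnW.
have yE : wroot p0 = act A U y by rewrite uE act_cat.
have zl : zeta l y = 0.
  by rewrite root_coord_act_notin // root_coord_alpha eq_sym (negPf jl) mul0r.
have zj : 0 < zeta j y.
  by rewrite root_coord_act_notin // root_coord_alpha_id halfnorm_gt0.
have yl : B y (al l) < 0 := ip_alpha_lt0 py zl zj Ap0.
have supp_l : supported cw i0 S q0 (al l).
  move=> i; have [->|il] := eqVneq i l; last first.
    by rewrite root_coord_alpha (negPf il) mul0r eqxx.
  move=> _ r rq rl; apply: contraT => Sr.
  by have := minq0 r; rewrite rl eqxx Sr leqNgt rq => /(_ isT).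
have supp_y : supported cw i0 S q0 y.
  by apply: supported_segment => //; exact: ltnW.
set x := act A U (al l).
have rx : isroot x by apply/isroot_act/isroot_alpha.
(* The letter l is initial in the window at q0, so the form is the alpha_l-coordinate of y. *)
have Exy : euler cw x (wroot p0) = 0.
  rewrite yE euler_transport //; have [c [e _]] := window_cons cw i0 q0.
  by rewrite e -/l lq0 euler_initial // -lq0 -e; exact: coxeter_window.
have Eyx : euler cw (wroot p0) x < 0.
  by have := euler_sym (wroot p0) x Hcw; rewrite Exy addr0 => ->; rewrite yE ip_act.
case: (boolP (posv x)) => px; last first.
  have rU : rword U by apply: rword_uword_le rw.
  have : - x \in roots U.
    apply: mem_roots_neg; first exact: isrootN.
      by rewrite root_negE.
    rewrite linearN /= act_revK root_negE ?negbK ?posv_alpha //.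
    exact: isroot_alpha.
  case/mem_roots_uword => a /andP[aq Sa] xa.
  have := euler_later_le0 Hcw nS (ltn_trans aq q0p0) Sa Sp0 rp0.
  by rewrite -xa eulerNr oppr_le0 leNgt Eyx.
(* Chosen so that s_j alpha_l = alpha_l + k alpha_j, which makes x + k times the root at p0 a
   root. *)
set k : R := - (A j l)%:~R.
have k0 : 0 < k.
  rewrite oppr_gt0 lt_neqAle lerz0 intr_eq0 cartan_neq0C Ap0.
  by case: HA => _ -> //.
have zE : x + k *: wroot p0 = act A U (act A v (refl A j (al l))).
  rewrite yE -linearZ -linearD /refl linearB linearZ /= fix_v mxE /k.
  by rewrite -scaleNr.
have pP : posv (wroot p0) by move: rp0; rewrite uwordS Sp0 rword_rcons => /andP[].
have rz : isroot (x + k *: wroot p0).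
  by rewrite zE; do 2!apply: isroot_act; exact: (isroot_act [:: j] (isroot_alpha l)).
exfalso; apply: (@complement_pair_false x (wroot p0) k) => //.
- exact: isroot_wroot.
- by apply: posvD => //; apply: posvZ => //; exact: ltW.
- apply: (@root_posv_zeta _ l); first exact: isroot_act.
  (* As l does not occur from q0 on, the rest of u^-1 preserves the positive alpha_l-coordinate. *)
  have lt_tail : l \notin rev (segment cw i0 S q0 P).
    rewrite mem_rev; apply/negP => /mem_segment[r [/andP[q0r _] Sr rl]].
    by have := no_l r q0r Sr; rewrite rl eqxx.
  rewrite yE -linearZ -linearD (uword_segment _ _ _ q0P) rev_cat act_cat act_revK.
  rewrite root_coord_act_notin // root_coordD root_coordZ zl mulr0 addr0.
  by rewrite root_coord_alpha_id halfnorm_gt0.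
- by rewrite -mem_rootsE //; [exact: wroot_mem|exact: isroot_wroot].
- by rewrite Exy.
Qed.

End SingletonIdeal.

(** * The weights of singletons *)

Lemma sortable_nested cw i0 u N : coxeter_word cw -> sortable R A cw u ->
  exists (S : pred nat) P,
    [/\ (N <= P)%N, nested cw i0 S, forall p, S p -> (p < P)%N,
        rword (uword cw i0 S P) & weq R A (uword cw i0 S P) u].
Proof.
move=> Hc [ps [[[sps rps eps] _] bps]].
pose S := [pred p | p \in ps]; pose P := (N + (\max_(p <- ps) p).+1)%N.
have SP p : S p -> (p < P)%N.
  move=> pS; rewrite /P addnS ltnS; apply: leq_trans (leq_addl _ _).
  by rewrite (big_rem p) //= leq_maxl.
have psE : [seq p <- iota 0 P | S p] = ps.
  apply: (irr_sorted_eq ltn_trans ltnn) => //.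
    exact/sorted_filter/iota_ltn_sorted/ltn_trans.
  move=> p; rewrite mem_filter mem_iota add0n /=.
  by apply: andb_idr; exact: SP.
have uE : uword cw i0 S P = letters cw ps by rewrite /uword psE (lettersE Hc i0).
exists S, P; rewrite uE; split=> //; first exact: leq_addr; last exact: reduced_rword.
have n0 := rank_gt0 i0.
have step p : S p -> (n <= p)%N -> S (p - n)%N.
  move=> pS np; set q := (p - n)%N.
  have pE : p = (1 * n + q)%N by rewrite mul1n subnKC.
  have pd : (p %/ n = (q %/ n).+1)%N by rewrite pE divnMDl.
  have : letter cw i0 p \in block cw ps (q %/ n).+1.
    rewrite inE (lettersE Hc i0) map_f // mem_filter size_coxeter // pd eqxx.
    exact: pS.
  move/(subsetP (bps _)); rewrite inE (lettersE Hc i0) => /mapP[r].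
  rewrite mem_filter size_coxeter // => /andP[/eqP rq rS] lE.
  suff -> : q = r by [].
  rewrite -(pos_letter Hc i0 r) -(pos_letter Hc i0 q) rq -lE.
  by rewrite pE letterD.
move=> q p qp pS lE.
have [m mE] : exists m, p = (m * n + q)%N.
  exists (p %/ n - q %/ n)%N.
  rewrite -[in LHS](pos_letter Hc i0 p) -[in X in (_ + X)%N](pos_letter Hc i0 q).
  by rewrite /pos lE addnA -mulnDl subnK // leq_div2r // ltnW.
elim: m p mE pS {qp lE} => [|m IH] p mE pS; first by rewrite mE in pS.
apply: (IH (p - n)%N); first by rewrite mE mulSn -addnA addKn.
by apply: step => //; rewrite mE mulSn -addnA leq_addr.
Qed.

(** By the ideal property m is the number of letters j. More than [height] of them would put the
    negative root beta_(j,h) = -beta_(j*,0) into a reduced word. *)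
Lemma singleton_cpow w0 cw u j : longest R A w0 -> coxeter_word cw ->
  singleton R A w0 cw u -> exists2 m, (m <= height cw w0 j)%N &
  act A u (omega R j) = cpow A cw m (omega R j).
Proof.
move=> L Hc [su au]; pose h := height cw w0 j.
have [S [P [hP nS SP rS wS]]] := sortable_nested j (h * n) Hc su.
have [S' [P' [_ nS' _ rS' wS']]] :=
  sortable_nested j 0 (coxeter_word_rev Hc) au.
have iS : ideal cw j S.
  apply: (nested_ideal L Hc nS nS' SP rS rS') => x.
  by rewrite wS' !act_cat wS.
exists (count_mem j (uword cw j S P)); last by rewrite -wS ideal_omega.
rewrite -/h -[leqRHS](@count_below _ Hc j (fun=> h) P j) //.
rewrite !count_map !count_filter; apply: sub_count => p /= /andP[/eqP pj Sp].
rewrite pj eqxx /= /below ltnNge; apply/negP => hp.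
have Sh : S (pos cw j h).
  have : (pos cw j h <= p)%N.
    by rewrite -[leqRHS](pos_letter Hc j) pj /pos leq_add2r leq_mul2r hp orbT.
  rewrite leq_eqVlt => /orP[/eqP -> //|lt].
  by apply: nS lt Sp _; rewrite letter_pos.
have := ideal_root Hc iS Sh; rewrite letter_pos // pos_div // beta_height //.
move=> e; have hP' : (pos cw j h < P)%N := SP _ Sh.
have : posv (act A (uword cw j S (pos cw j h)) (al j)).
  have /(rword_uword_le hP') : rword (uword cw j S P) := rS.
  by rewrite uwordS Sh rword_rcons letter_pos // => /andP[].
rewrite e => /negP[]; rewrite root_negE ?posv_beta0 //.
exact: isroot_beta.
Qed.

Lemma row_of_pairing (f : 'I_n -> R) : exists a : 'rV[R]_n,
  forall j, B a (omega R j) = f j.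
Proof.
have Gu : G \in unitmx.
  rewrite -row_free_unit -kermx_eq0; apply/rowV0P => v /sub_kermxP vG.
  by apply: contraTeq isT => /ip_gt0; rewrite /ip vG mul0mx mxE ltxx.
exists (\row_j f j *m invmx G) => j; rewrite /ip mulmxKV // mxE (bigD1 j) //=.
rewrite !mxE !eqxx mulr1 big1 ?addr0 // => k kj.
by rewrite !mxE (negPf kj) mulr0.
Qed.

End Geometry.

Theorem theorem2p5 (R : realType) (n : nat) (A : 'M[int]_n) (G : 'M[R]_n)
    (w0 cw : seq 'I_n) :
  finite_type R A -> W_inv_inner A G -> longest R A w0 -> coxeter_word cw ->
  forall f : 'I_n -> R,
    (forall i, f i = f (istar R A w0 i)) ->
    (forall j, 0 < \sum_i (A i j)%:~R * f i) ->
    exists a : 'rV[R]_n,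
      (forall i, 0 <= a 0 i) /\
      (forall phi : 'rV[R]_n, Asso_a A G w0 cw a phi <-> Asso_f A w0 cw f phi).
Proof.
case=> HA _ HG L Hc f _ f_pos; have Gsym : G^T = G by case: HG.
have [a aE] := row_of_pairing HG f.
exists a; split=> [j|phi].
  (* The coordinate a_j times d_j is B(a, alpha_j), the sum of a_ij f(i). *)
  rewrite -(pmulr_lge0 _ (halfnorm_gt0 HA HG j)) -ip_alphar // alpha_sum.
  rewrite ip_sumr //; apply: ltW; apply: lt_le_trans (f_pos j) _.
  by apply: ler_sum => i _; rewrite ipZr // aE.
split=> h.
  move=> i k m /(is_hE HA HG Hc i L) -> mk.
  have [u su <-] := exists_singleton HA HG L Hc mk.
  by rewrite -aE; exact: h.
move=> u su j; rewrite aE; have [m mh ->] := singleton_cpow HA HG j L Hc su.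
by apply: h mh; exact: is_h_height.
Qed.
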